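(* Let $\mathcal{U}$ be a sufficiently saturated generic difference field of characteristic $0$, let $K\subset\mathcal{U}$ be a difference subfield, let $A\in\mathrm{GL}_n(K)$, and let $R'$ be a Picard-Vessiot ring for $\sigma(X)=AX$ over $K$. Assume that $C_{R'}=C_K=D_K$. Then the algebraic groups $G_{R'}$ and $\mathbb{H}$ are isomorphic (as algebraic groups over the algebraically closed field $\mathcal{U}$).
   Context: All fields have characteristic $0$. A difference ring (field) is a commutative ring with $1$ (a field) with a distinguished automorphism $\sigma$. For a difference ring $S$: $C_S=\{a\in S:\sigma(a)=a\}$, $D_S=\{a\in S:\sigma^m(a)=a\text{ for some }m\neq0\}$. A Picard-Vessiot ring for $\sigma(X)=AX$ over $K$ is a difference ring extension $R'=K[y,\det(y)^{-1}]$ of $K$, $y\in\mathrm{GL}_n(R')$, $\sigma(y)=Ay$, with no $\sigma$-invariant ideals other than $(0)$ and $R'$. When $C_{R'}=C_K$, the functor sending a commutative $C_K$-algebra $B$ to the group of $K\otimes_{C_K}B$-linear automorphisms of $R'\otimes_{C_K}B$ commuting with $\sigma$ (where $\sigma(f\otimes b)=\sigma(f)\otimes b$) is represented by a linear algebraic group $G_{R'}$ over $C_K$. A difference field $\mathcal{U}$ is generic if every finite system of difference equations with coefficients in $\mathcal{U}$ that has a solution in a difference field containing $\mathcal{U}$ has a solution in $\mathcal{U}$. A finite $\sigma$-stable extension of a difference field $F$ is a finite separable algebraic extension $M$ of $F$ with $\sigma(M)=M$. Fix an infinite cardinal $\kappa$ larger than the cardinals of all structures considered other than $\mathcal{U}$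 and its associated large structures (in particular $|K|<\kappa$). $\mathcal{U}$ is sufficiently saturated if: (i) the genericity property holds for systems of size $<\kappa$ (in infinitely many variables); (ii) any isomorphism between two algebraically closed difference subfields of $\mathcal{U}$ of cardinality $<\kappa$ extends to an automorphism of $\mathcal{U}$; (iii) if $F\subset E$ are difference fields of cardinality $<\kappa$ with $F\subset\mathcal{U}$, and every finite $\sigma$-stable extension of $F$ contained in $E$ embeds over $F$ in $\mathcal{U}$, then $E$ embeds over $F$ in $\mathcal{U}$. The group $\mathbb{H}$: let $R=K[Y,\det(Y)^{-1}]$, $Y$ an $n\times n$ matrix of indeterminates, $\sigma(Y)=AY$, and let $L$ be the field of fractions of $R$. $L$ is a regular extension of $K$, so there is a $K$-embedding $\varphi:L\to\mathcal{U}$ of difference fields. Let $T=\varphi(Y)$ and let $W\subset\mathrm{GL}_n$ be the algebraic locus of $T$ over $KC_{\mathcal{U}}$ (the smallest algebraic subset of $\mathrm{GL}_n$ defined over $KC_{\mathcal{U}}$ containing $T$). It is defined over $KC_{\varphi(L)}$. $\mathbb{H}$ is the algebraic subgroup of $\mathrm{GL}_n$ of matrices $h$ leaving $W$ invariant under right multiplication ($Wh=W$). Its group of points $\mathbb{H}(C_{\mathcal{U}})$ is identified, via $g\mapsto T^{-1}g(T)$, with the group of difference automorphisms of $K(\mathcal{S})$ over $KC_{\mathcal{U}}$, where $\mathcal{S}$ is the set of solutions in $\mathcal{U}$ of $\sigma(X)=AX$, $\det(X)\neq0$. *)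

(* Defs.v *)
From HB Require Import structures.
From mathcomp Require Import all_boot all_order all_algebra.
From mathcomp Require Import fraction generic_quotient.
From mathcomp Require Import boolp classical_sets cardinality.
From mathcomp Require Import mpoly.

Set Implicit Arguments.
Unset Strict Implicit.
Unset Printing Implicit Defensive.

Import GRing.Theory.
Local Open Scope ring_scope.
Local Open Scope quotient_scope.
Local Open Scope classical_set_scope.
Local Open Scope card_scope.

(** * Difference rings and fields *)

Record diffRing := DiffRing {
  dring :> comUnitRingType;
  rsigma : {rmorphism dring -> dring};
  rsigma_bij : bijective rsigma }.

Record diffField := DiffField {
  dfield :> fieldType;
  dsigma : {rmorphism dfield -> dfield};
  dsigma_bij : bijective dsigma;
  dfield_char0 : [pchar dfield] =i pred0 }.

Arguments rsigma {_}.
Arguments dsigma {_}.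

(* A difference field [E] "contains" [F] through an embedding; "over" and
   "extends" are commutation with the embeddings at hand. *)
Definition diff_morph (F E : diffField) (f : {rmorphism F -> E}) : Prop :=
  forall x, f (dsigma x) = dsigma (f x).

Definition constants (F : diffField) : {pred F} := fun a => dsigma a == a.

Arguments constants : clear implicits.

Lemma constants_divring (F : diffField) : divring_closed (constants F).
Proof.
split; first by rewrite unfold_in rmorph1.
- by move=> x y /eqP xC /eqP yC; rewrite unfold_in rmorphB /= xC yC.
- by move=> x y /eqP xC /eqP yC; rewrite unfold_in fmorph_div /= xC yC.
Qed.

HB.instance Definition _ (F : diffField) :=
  GRing.isDivringClosed.Build F (constants F) (@constants_divring F).

Definition constField (F : diffField) := {a : F | a \in constants F}.

HB.instance Definition _ (F : diffField) := SubChoice.on (constField F).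
HB.instance Definition _ (F : diffField) :=
  [SubChoice_isSubComUnitRing of constField F by <:].
HB.instance Definition _ (F : diffField) :=
  [SubComUnitRing_isSubIntegralDomain of constField F by <:].
HB.instance Definition _ (F : diffField) :=
  [SubIntegralDomain_isSubField of constField F by <:].

(* [C_F = D_F]; negative exponents add nothing since sigma is bijective. *)
Definition periodic_are_constant (F : diffField) : Prop :=
  forall (m : nat) (a : F), (0 < m)%N -> iter m dsigma a = a -> a \in constants F.

(** * Generic and sufficiently saturated difference fields *)

(* Difference polynomials over [F] in the variables [V]. *)
Inductive dpoly (F V : Type) : Type :=
| DConst of F
| DVar of V
| DAdd of dpoly F V & dpoly F V
| DMul of dpoly F V & dpoly F V
| DSigma of dpoly F V.

Fixpoint deval (F V : Type) (E : diffField) (f : F -> E) (x : V -> E)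
    (p : dpoly F V) : E :=
  match p with
  | DConst c => f c
  | DVar v => x v
  | DAdd p q => deval f x p + deval f x q
  | DMul p q => deval f x p * deval f x q
  | DSigma p => dsigma (deval f x p)
  end.

Definition has_solution (F V I : Type) (S : I -> dpoly F V)
    (E : diffField) (f : F -> E) : Prop :=
  exists x : V -> E, forall i, deval f x (S i) = 0.

(* The system [S] has a solution in [U] as soon as it has one in some
   difference field containing [U]. *)
Definition solvable_if_consistent (U : diffField) (V I : Type)
    (S : I -> dpoly U V) : Prop :=
  (exists (E : diffField) (f : {rmorphism U -> E}),
      diff_morph f /\ has_solution S f) ->
  has_solution S (@id U).

Definition generic (U : diffField) : Prop :=
  forall (n m : nat) (S : 'I_m -> dpoly U 'I_n), solvable_if_consistent S.

Definition smaller (X kappa : Type) : Prop :=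
  ([set: X] #<= [set: kappa]) /\ ~ ([set: kappa] #<= [set: X]).

Definition finite_extension (F M : fieldType) (f : {rmorphism F -> M}) : Prop :=
  exists (d : nat) (b : 'I_d -> M),
    forall x : M, exists c : 'I_d -> F, x = \sum_j f (c j) * b j.

Definition alg_closed (F : fieldType) : Prop :=
  forall p : {poly F}, (1 < size p)%N -> exists x, root p x.

Definition large_systems (kappa : Type) (U : diffField) : Prop :=
  forall (V I : Type) (S : I -> dpoly U V),
    smaller V kappa -> smaller I kappa -> solvable_if_consistent S.

Definition homogeneous (kappa : Type) (U : diffField) : Prop :=
  forall (F1 F2 : diffField)
         (i1 : {rmorphism F1 -> U}) (i2 : {rmorphism F2 -> U})
         (g : {rmorphism F1 -> F2}),
    diff_morph i1 -> diff_morph i2 -> diff_morph g -> bijective g ->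
    alg_closed F1 -> alg_closed F2 -> smaller F1 kappa -> smaller F2 kappa ->
  exists tau : {rmorphism U -> U},
    [/\ diff_morph tau, bijective tau & forall x, tau (i1 x) = i2 (g x)].

(* Separability of [M] over [F] is automatic in characteristic 0, and
   sigma(M) = M holds because [M] is a difference field of its own. *)
Definition extension_property (kappa : Type) (U : diffField) : Prop :=
  forall (F E : diffField) (i : {rmorphism F -> U}) (e : {rmorphism F -> E}),
    diff_morph i -> diff_morph e -> smaller F kappa -> smaller E kappa ->
    (forall (M : diffField) (f : {rmorphism F -> M}) (g : {rmorphism M -> E}),
        diff_morph f -> diff_morph g -> (forall x, g (f x) = e x) ->
        finite_extension f ->
      exists h : {rmorphism M -> U},
        diff_morph h /\ forall x, h (f x) = i x) ->
  exists h : {rmorphism E -> U}, diff_morph h /\ forall x, h (e x) = i x.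

Record sufficiently_saturated (kappa : Type) (U : diffField) : Prop := {
  sat_infinite : infinite_set [set: kappa];
  sat_systems : large_systems kappa U;
  sat_homogeneous : homogeneous kappa U;
  sat_extension : extension_property kappa U }.

(** * Picard-Vessiot rings *)

(* [eta] is the inclusion of [K] in [R]. The last clause is sigma-simplicity:
   [idealr_closed] means "proper ideal". *)
Record picard_vessiot (K : diffField) (n : nat) (A : 'M[K]_n)
    (R : diffRing) (eta : {rmorphism K -> R}) : Prop := {
  pv_extension : forall a, eta (dsigma a) = rsigma (eta a);
  pv_generated : exists y : 'M[R]_n,
    [/\ y \in unitmx,
        map_mx rsigma y = map_mx eta A *m y &
        forall S : {pred R}, subring_closed S ->
          (forall a, eta a \in S) -> (forall i j, y i j \in S) ->
          (\det y)^-1 \in S -> forall x, x \in S];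
  pv_simple : forall I : {pred R}, idealr_closed I ->
    (forall x, x \in I -> rsigma x \in I) -> forall x, x \in I -> x = 0 }.

(* [C_R = C_K] *)
Definition no_new_constants (K : diffField) (R : diffRing)
    (eta : {rmorphism K -> R}) : Prop :=
  forall r : R, rsigma r = r -> exists2 a, a \in constants K & r = eta a.

(** * Tensor products of commutative algebras

   A commutative [k]-algebra is a commutative ring with a ring morphism from
   [k]. A formal sum of pure tensors is a sequence of pairs; two of them are
   identified when no [k]-balanced biadditive map separates them. *)

Section Tensor.
Variables (k R B : comNzRingType) (i : {rmorphism k -> R}) (j : {rmorphism k -> B}).

Record balanced (V : zmodType) (h : R -> B -> V) : Prop := {
  balanced_addl : forall b x y, h (x + y) b = h x b + h y b;
  balanced_addr : forall r x y, h r (x + y) = h r x + h r y;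
  balanced_scale : forall c r b, h (i c * r) b = h r (j c * b) }.

Definition formal_eval (V : zmodType) (h : R -> B -> V) (s : seq (R * B)) : V :=
  \sum_(p <- s) h p.1 p.2.

Definition tensor_eq (s t : seq (R * B)) : bool :=
  `[< forall (V : zmodType) (h : R -> B -> V),
        balanced h -> formal_eval h s = formal_eval h t >].

Lemma tensor_eq_refl : reflexive tensor_eq.
Proof. by move=> s; apply/asboolP. Qed.

Lemma tensor_eq_sym : ssrbool.symmetric tensor_eq.
Proof.
by move=> s t; apply/asboolP/asboolP=> H V h bh; rewrite H.
Qed.

Lemma tensor_eq_trans : transitive tensor_eq.
Proof.
by move=> t s u /asboolP st /asboolP tu; apply/asboolP=> V h bh; rewrite st ?tu.
Qed.

Canonical tensor_equiv :=
  EquivRel tensor_eq tensor_eq_refl tensor_eq_sym tensor_eq_trans.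

Definition tensor := {eq_quot tensor_equiv}.

HB.instance Definition _ := Choice.on tensor.

Definition pure (r : R) (b : B) : tensor := \pi_tensor [:: (r, b)].

Definition tensor_lift (V : zmodType) (h : R -> B -> V) (x : tensor) : V :=
  formal_eval h (repr x).

Lemma tensor_liftE (V : zmodType) (h : R -> B -> V) s :
  balanced h -> tensor_lift h (\pi_tensor s) = formal_eval h s.
Proof.
move=> bh; rewrite /tensor_lift.
have /eqmodP/asboolP H : repr (\pi_tensor s) = s %[mod tensor] by rewrite reprK.
exact: H.
Qed.

Lemma tensor_ext (x y : tensor) :
  (forall (V : zmodType) (h : R -> B -> V),
     balanced h -> tensor_lift h x = tensor_lift h y) -> x = y.
Proof.
by move=> H; rewrite -[x]reprK -[y]reprK; apply/eqmodP/asboolP.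
Qed.

Definition tensor_zero : tensor := \pi_tensor [::].
Definition tensor_opp (x : tensor) : tensor :=
  \pi_tensor [seq (- p.1, p.2) | p <- repr x].
Definition tensor_add (x y : tensor) : tensor := \pi_tensor (repr x ++ repr y).
Definition tensor_one : tensor := pure 1 1.
Definition tensor_mul (x y : tensor) : tensor :=
  \pi_tensor [seq (p.1 * q.1, p.2 * q.2) | p <- repr x, q <- repr y].

Section Lift.
Variables (V : zmodType) (h : R -> B -> V).
Hypothesis bh : balanced h.

Lemma balanced_oppl r b : h (- r) b = - h r b.
Proof.
have h0 : h 0 b = 0.
  by apply: (addrI (h 0 b)); rewrite -balanced_addl // !addr0.
by apply: (addrI (h r b)); rewrite -balanced_addl // !subrr.
Qed.

Lemma lift_zero : tensor_lift h tensor_zero = 0.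
Proof. by rewrite tensor_liftE // /formal_eval big_nil. Qed.

Lemma lift_add x y :
  tensor_lift h (tensor_add x y) = tensor_lift h x + tensor_lift h y.
Proof. by rewrite tensor_liftE // /formal_eval big_cat. Qed.

Lemma lift_opp x : tensor_lift h (tensor_opp x) = - tensor_lift h x.
Proof.
rewrite tensor_liftE // /formal_eval big_map -sumrN.
by apply: eq_bigr => p _; rewrite balanced_oppl.
Qed.

Lemma lift_pure r b : tensor_lift h (pure r b) = h r b.
Proof. by rewrite tensor_liftE // /formal_eval big_seq1. Qed.

Lemma balanced_mul r b : balanced (fun r' b' => h (r * r') (b * b')).
Proof.
split=> [b' x y|r' x y|c r' b'].
- by rewrite mulrDr balanced_addl.
- by rewrite mulrDr balanced_addr.
- by rewrite mulrCA balanced_scale // mulrCA.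
Qed.

Lemma balanced_lift_mul y :
  balanced (fun r b => tensor_lift (fun r' b' => h (r * r') (b * b')) y).
Proof.
rewrite /tensor_lift /formal_eval; split=> [b r s|r b c|c r b].
- by rewrite -big_split; apply: eq_bigr => p _; rewrite mulrDl balanced_addl.
- by rewrite -big_split; apply: eq_bigr => p _; rewrite mulrDl balanced_addr.
- by apply: eq_bigr => p _; rewrite -!mulrA balanced_scale.
Qed.

Lemma lift_mul x y :
  tensor_lift h (tensor_mul x y) =
  tensor_lift (fun r b => tensor_lift (fun r' b' => h (r * r') (b * b')) y) x.
Proof. by rewrite tensor_liftE // /formal_eval big_allpairs_dep. Qed.

End Lift.

Lemma tensor_addA : associative tensor_add.
Proof.
by move=> x y z; apply: tensor_ext => V h bh; rewrite !lift_add // addrA.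
Qed.

Lemma tensor_addC : commutative tensor_add.
Proof.
by move=> x y; apply: tensor_ext => V h bh; rewrite !lift_add // addrC.
Qed.

Lemma tensor_add0 : left_id tensor_zero tensor_add.
Proof.
by move=> x; apply: tensor_ext => V h bh; rewrite lift_add // lift_zero // add0r.
Qed.

Lemma tensor_addN : left_inverse tensor_zero tensor_opp tensor_add.
Proof.
move=> x; apply: tensor_ext => V h bh.
by rewrite lift_add // lift_opp // lift_zero // addNr.
Qed.

HB.instance Definition _ :=
  GRing.isZmodule.Build tensor tensor_addA tensor_addC tensor_add0 tensor_addN.

Lemma tensor_mulC : commutative tensor_mul.
Proof.
move=> x y; apply: tensor_ext => V h bh; rewrite !lift_mul //.
rewrite /tensor_lift /formal_eval exchange_big /=.
by apply: eq_bigr => p _; apply: eq_bigr => q _; rewrite mulrC [X in h _ X]mulrC.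
Qed.

Lemma tensor_mulA : associative tensor_mul.
Proof.
move=> x y z; apply: tensor_ext => V h bh; rewrite !lift_mul //; last first.
  exact: balanced_lift_mul.
apply: eq_bigr => p _; rewrite lift_mul; last exact: balanced_mul.
by apply: eq_bigr => q _; apply: eq_bigr => s _; rewrite !mulrA.
Qed.

Lemma tensor_mul1 : left_id tensor_one tensor_mul.
Proof.
move=> x; apply: tensor_ext => V h bh.
rewrite lift_mul // lift_pure; last exact: balanced_lift_mul.
by apply: eq_bigr => p _; rewrite !mul1r.
Qed.

Lemma tensor_mulDl : left_distributive tensor_mul +%R.
Proof.
move=> x y z; apply: tensor_ext => V h bh.
have bz := balanced_lift_mul bh z.
by rewrite lift_mul // !lift_add // !lift_mul.
Qed.

HB.instance Definition _ := GRing.Zmodule_isComPzRing.Build tensor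
  tensor_mulA tensor_mulC tensor_mul1 tensor_mulDl.

Lemma pure_balanced : balanced pure.
Proof.
by split=> *; apply: tensor_ext => V h bh;
   rewrite ?lift_add ?lift_pure ?balanced_addl ?balanced_addr ?balanced_scale.
Qed.

Lemma pure_mul r b r' b' : pure r b * pure r' b' = pure (r * r') (b * b').
Proof.
apply: tensor_ext => V h bh; rewrite lift_mul // !lift_pure //.
- exact: balanced_mul.
- exact: balanced_lift_mul.
Qed.

Lemma tensor_sum_pure (x : tensor) : x = \sum_(p <- repr x) pure p.1 p.2.
Proof.
apply: tensor_ext => V h bh; rewrite {1}/tensor_lift /formal_eval.
elim: (repr x) => [|p s IH]; first by rewrite !big_nil lift_zero.
by rewrite !big_cons lift_add // lift_pure // IH.
Qed.

End Tensor.

(* [f (x) g]; meaningful when [f] and [g] are [k]-linear, see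
   [tensor_map_pure]. *)
Definition tensor_map (k R B R' B' : comNzRingType)
    (i : {rmorphism k -> R}) (j : {rmorphism k -> B})
    (i' : {rmorphism k -> R'}) (j' : {rmorphism k -> B'})
    (f : R -> R') (g : B -> B') (x : tensor i j) : tensor i' j' :=
  tensor_lift (fun r b => pure i' j' (f r) (g b)) x.

Lemma tensor_map_pure (k R B R' B' : comNzRingType)
    (i : {rmorphism k -> R}) (j : {rmorphism k -> B})
    (i' : {rmorphism k -> R'}) (j' : {rmorphism k -> B'})
    (f : {rmorphism R -> R'}) (g : {rmorphism B -> B'}) r b :
  (forall c, f (i c) = i' c) -> (forall c, g (j c) = j' c) ->
  tensor_map i' j' f g (pure i j r b) = pure i' j' (f r) (g b).
Proof.
move=> fi gj; apply: lift_pure; have bp := pure_balanced i' j'.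
split=> [c x y|x c d|c x y].
- by rewrite rmorphD (balanced_addl bp).
- by rewrite rmorphD (balanced_addr bp).
- by rewrite !rmorphM fi gj (balanced_scale bp).
Qed.

(** * Linear algebraic groups and the group scheme of a Picard-Vessiot ring *)

(* Coordinates on m x m matrices are the m * m indeterminates, in the order of
   [mxvec]. *)
Definition mx_eval (k B : comNzRingType) (j : {rmorphism k -> B}) (m : nat)
    (g : 'M[B]_m) (p : {mpoly k[m * m]}) : B :=
  mmap j (fun v => mxvec g 0 v) p.

(* The [B]-points of the closed subscheme of GL_m cut out by [S]. *)
Definition gl_points (k : comNzRingType) (m : nat) (S : set {mpoly k[m * m]})
    (B : comNzRingType) (j : {rmorphism k -> B}) : set 'M[B]_m :=
  [set g | (exists d, \det g * d = 1) /\ forall p, S p -> mx_eval j g p = 0].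

(* A linear algebraic group over [k]: a closed subgroup scheme of some GL_m.
   (In characteristic 0 it is automatically reduced.) *)
Record linAlgGroup (k : comNzRingType) := LinAlgGroup {
  lag_dim : nat;
  lag_eqs : set {mpoly k[lag_dim * lag_dim]};
  lag_one : forall (B : comNzRingType) (j : {rmorphism k -> B}),
    gl_points lag_eqs j 1%:M;
  lag_mul : forall (B : comNzRingType) (j : {rmorphism k -> B}) g h,
    gl_points lag_eqs j g -> gl_points lag_eqs j h ->
    gl_points lag_eqs j (g *m h);
  lag_inv : forall (B : comNzRingType) (j : {rmorphism k -> B}) g h,
    gl_points lag_eqs j g -> g *m h = 1%:M -> gl_points lag_eqs j h }.

Definition points (k : comNzRingType) (G : linAlgGroup k) (B : comNzRingType)
    (j : {rmorphism k -> B}) : set 'M[B]_(lag_dim G) :=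
  gl_points (@lag_eqs k G) j.

Arguments points {k} G {B} j.

(* The constants of [K] as a coefficient field for any [K]-algebra [R]. *)
Definition const_incl (K : diffField) (R : comNzRingType)
    (eta : {rmorphism K -> R}) : {rmorphism constField K -> R} := eta \o val.

Section GaloisFunctor.
Variables (K : diffField) (R : diffRing) (eta : {rmorphism K -> R}).

Section Aut.
Variables (B : comNzRingType) (j : {rmorphism constField K -> B}).

(* [R (x) B] over the constants of [K] *)
Definition base_change := tensor (const_incl eta) j.

Definition base_sigma : base_change -> base_change :=
  tensor_map (const_incl eta) j rsigma idfun.

Lemma base_sigma_pure r b : (forall a, eta (dsigma a) = rsigma (eta a)) ->
  base_sigma (pure (const_incl eta) j r b) = pure (const_incl eta) j (rsigma r) b.
Proof.
move=> eta_sigma; rewrite /base_sigma.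
rewrite (tensor_map_pure (f := rsigma) (g := idfun)) // => c /=.
by rewrite -eta_sigma (eqP (valP c)).
Qed.

(* Automorphisms of the ring [R (x) B], linear over [K (x) B] and commuting
   with sigma. *)
Definition diff_aut (f : {rmorphism base_change -> base_change}) : Prop :=
  [/\ bijective f,
      forall a b t, f (pure (const_incl eta) j (eta a) b * t)
                    = pure (const_incl eta) j (eta a) b * f t
    & forall t, f (base_sigma t) = base_sigma (f t)].

End Aut.

(* [theta] is an isomorphism of group functors from the functor of points of
   [G] to [B |-> diff_aut B]. For [u : B -> B'], the automorphism of
   [R (x) B'] induced by [f] is the one that intertwines with [f] along [1 (x) u]. *)
Definition represents_diff_aut (G : linAlgGroup (constField K)) : Prop :=
  exists theta : forall (B : comNzRingType) (j : {rmorphism constField K -> B}),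
      'M[B]_(lag_dim G) -> {rmorphism base_change j -> base_change j},
  [/\ forall B j g, points G j g -> diff_aut (theta B j g),
      forall B j f, diff_aut f ->
        exists2 g, points G j g & theta B j g =1 f,
      forall B j g h, points G j g -> points G j h ->
        theta B j g =1 theta B j h -> g = h,
      forall B j g h, points G j g -> points G j h ->
        theta B j (g *m h) =1 theta B j g \o theta B j h
    & forall (B B' : comNzRingType) (j : {rmorphism constField K -> B})
             (j' : {rmorphism constField K -> B'}) (u : {rmorphism B -> B'}) g,
        (forall c, u (j c) = j' c) -> points G j g ->
        forall t, theta B' j' (map_mx u g) (tensor_map (const_incl eta) j' idfun u t)
                  = tensor_map (const_incl eta) j' idfun u (theta B j g t)].

End GaloisFunctor.

(** * The group H *)

Section AlgebraicSets.
Variables (U : diffField) (n : nat).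

Definition gl_zeros (S : set {mpoly U[n * n]}) : set 'M[U]_n :=
  [set M | M \in unitmx /\ forall p, S p -> mx_eval idfun M p = 0].

Definition defined_over (F : set U) (X : set 'M[U]_n) : Prop :=
  exists2 S : set {mpoly U[n * n]},
    (forall p m, S p -> F p@_m) & X = gl_zeros S.

(* The smallest algebraic subset of GL_n defined over [F] containing [T]. *)
Definition locus (F : set U) (T : 'M[U]_n) : set 'M[U]_n :=
  [set M | forall X, defined_over F X -> X T -> X M].

Definition right_stabilizer (W : set 'M[U]_n) : set 'M[U]_n :=
  [set h | h \in unitmx /\ [set M *m h | M in W] = W].

End AlgebraicSets.

(* The compositum of the image of [K] and the constants of [U]. *)
Definition KCU (K U : diffField) (iota : {rmorphism K -> U}) : set U :=
  [set x | forall S : {pred U}, divring_closed S ->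
     (forall a, iota a \in S) -> {subset constants U <= S} -> x \in S].

Section GenericSolution.
Variables (K : diffField) (n : nat).

(* The fraction field of K[Y], which is also that of K[Y, 1/det Y]. *)
Definition genField := {fraction {mpoly K[n * n]}}.

Definition genConst (a : K) : genField := tofrac (a%:MP_[n * n]).

Definition genY : 'M[genField]_n :=
  \matrix_(i, j) tofrac ('X_(mxvec_index i j) : {mpoly K[n * n]}).

End GenericSolution.

Definition groupH (K U : diffField) (iota : {rmorphism K -> U}) (n : nat)
    (phi : {rmorphism genField K n -> U}) : set 'M[U]_n :=
  right_stabilizer (locus (KCU iota) (map_mx phi (genY K n))).

(** * Isomorphisms of linear algebraic groups over an algebraically closed
   field, given by their groups of points *)

(* The coordinate ring of GL_m is generated by the entries and 1/det. *)
Definition regular_on (U : fieldType) (m n : nat) (X : set 'M[U]_m)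
    (f : 'M[U]_m -> 'M[U]_n) : Prop :=
  exists (P : 'M[{mpoly U[m * m]}]_n) (e : nat), forall g, X g ->
    forall i j, f g i j = mx_eval idfun g (P i j) / (\det g) ^+ e.

Definition alg_group_isom (U : fieldType) (m n : nat)
    (X : set 'M[U]_m) (Y : set 'M[U]_n) : Prop :=
  exists (f : 'M[U]_m -> 'M[U]_n) (f' : 'M[U]_n -> 'M[U]_m),
  [/\ regular_on X f, regular_on Y f',
      forall g, X g -> Y (f g) /\ f' (f g) = g,
      forall h, Y h -> X (f' h) /\ f (f' h) = h
    & forall g h, X g -> X h -> f (g *m h) = f g *m f h].

(* Main.v *)
(* Write C for the constants of U, V for the set of values of y under ring
   morphisms R' -> U over K, W for the locus of T. By sigma-simplicity of R' and
   of U, a sigma-stable system of relations in R' (x) B, or in U (x)_C B, that is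
   killed by a suitable evaluation is already zero. This descent principle gives:
   - V is nonempty. In R' (x)_K U the solutions y and T differ by a constant
     matrix, and the relations T Z in V descend to constant coefficients.
     The periodic elements of U form an algebraically closed field that contains
     C, and C is uncountable by saturation, so a solution Z in U exists.
   - If T c lies in V, then W c = V.
   An automorphism g of R' (x) B maps y to y rho(g) with rho(g) over B, since
   the constants of R' (x) B are B. For B = U, V is stable under rho(g), so
   g |-> c rho(g) c^-1 takes values in H. Conversely y |-> y c^-1 h c defines an
   automorphism for h in H, by descent again. Both maps are regular because they
   are evaluations of the same construction at a universal point, with values in
   the ring of regular functions on G(U), respectively on H. *)

Require Import Defs.
From HB Require Import structures.
From mathcomp Require Import all_boot all_order all_algebra all_field.
From mathcomp Require Import fraction boolp classical_sets functions cardinality mpoly.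

Set Implicit Arguments.
Unset Strict Implicit.
Unset Printing Implicit Defensive.

Import GRing.Theory.
Local Open Scope ring_scope.

(** * Linear forms *)

(** The maps that define V are ring morphisms over K with no condition on sigma. This is what allows
    [c] to have merely periodic entries: the constants of U need not be algebraically closed, so a
    constant matrix [c] cannot be expected. Descent survives because precomposing with an iterate of
    sigma multiplies y and T on the left by one and the same matrix over K and leaves the right
    factor [c] untouched. Vanishing in a tensor product over a field is tested by contracting one
    factor with all linear forms, and the choice of factor decides where the resulting relation
    lives. Relations are syntax trees in the entries of a matrix and of its inverse, so that
    substituting a product of matrices splits a relation into sums of products, one factor for each
    matrix. The functions on G(U) or on H form a ring of actual functions. An identity at the
    universal point is therefore checked at ordinary points, where it follows from descent. *)

Section LinearForms.
Variables (k : fieldType) (F : comPzRingType) (i : {rmorphism k -> F}).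

Definition linear_form (l : F -> k) : Prop :=
  (forall x y, l (x + y) = l x + l y) /\ (forall c x, l (i c * x) = c * l x).

Section Theory.
Variables (l : F -> k) (ll : linear_form l).

Lemma linear_form0 : l 0 = 0.
Proof. by rewrite -[X in l X](mulr0 (i 0)) ll.2 mul0r. Qed.

Lemma linear_formN x : l (- x) = - l x.
Proof. by rewrite -mulN1r -(rmorph1 i) -rmorphN ll.2 mulN1r. Qed.

Lemma linear_form_sum (I : Type) (r : seq I) (f : I -> F) :
  l (\sum_(p <- r) f p) = \sum_(p <- r) l (f p).
Proof. exact: (big_morph l ll.1 linear_form0). Qed.
End Theory.

(** By Zorn there is a subspace [A] maximal among those missing [x]. Then [F] is the sum of [A] and
    the line of [x], and the coefficient along [x] is the form. *)
Lemma linear_form_separates (x : F) : x != 0 ->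
  exists2 l, linear_form l & l x = 1.
Proof.
move=> x0.
pose sub (A : set F) := [/\ forall u v, A u -> A v -> A (u + v),
  forall c u, A u -> A (i c * u) & ~ A x].
have [C Csub Ctot|A [[Aadd Amul Ax] Amax]] := @Zorn_bigcup F sub.
  split=> [u v [X CX Xu] [Y CY Yv]|c u [X CX Xu]|[X CX Xx]].
  - have [XY|YX] := Ctot _ _ CX CY.
      by exists Y => //; have [+ _ _] := Csub _ CY; apply=> //; exact: XY.
    by exists X => //; have [+ _ _] := Csub _ CX; apply=> //; exact: YX.
  - by exists X => //; have [_ + _] := Csub _ CX; apply.
  - by have [_ _ +] := Csub _ CX.
have A0 : A 0.
  apply: contrapT => nA0; apply: (Amax (fun u => u = 0)).
    split=> [u Au|]; last by move=> /(_ 0 erefl).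
    by case: nA0; rewrite -(mul0r u) -(rmorph0 i); exact: Amul.
  by split=> [u v -> ->|c u ->|/eqP]; rewrite ?addr0 ?mulr0 ?(negbTE x0).
(* Otherwise the span of [A] and [u] would still miss [x]. *)
have dec u : exists c, A (u - i c * x).
  apply: contrapT => Nc; have nAu : ~ A u.
    by move=> Au; apply: Nc; exists 0; rewrite rmorph0 mul0r subr0.
  apply: (Amax (fun v => exists2 a, A a & exists c, v = a + i c * u)).
    split=> [v Av|]; first by exists v => //; exists 0; rewrite rmorph0 mul0r addr0.
    by move=> /(_ u); apply: contra_not nAu => /(_ _); apply;
      exists 0 => //; exists 1; rewrite rmorph1 mul1r add0r.
  split=> [_ _ [a Aa [c ->]] [b Ab [d ->]]|e _ [a Aa [c ->]]|[a Aa [c xE]]].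
  - by exists (a + b); [exact: Aadd | exists (c + d); rewrite rmorphD mulrDl addrACA].
  - by exists (i e * a); [exact: Amul | exists (e * c); rewrite rmorphM mulrDr mulrA].
  - have [c0|c0] := eqVneq c 0.
      by apply: Ax; rewrite xE c0 rmorph0 mul0r addr0.
    apply: Nc; exists c^-1.
    have -> : u - i c^-1 * x = i (- c^-1) * a.
      rewrite xE mulrDr mulrA -rmorphM mulVf // rmorph1 mul1r.
      by rewrite opprD addrCA subrr addr0 rmorphN mulNr.
    exact: Amul.
have [l lP] := choice dec.
have uniq u c : A (u - i c * x) -> l u = c.
  move=> Auc; apply: contrapT => /eqP; rewrite -subr_eq0 => d0; apply: Ax.
  have -> : x = i ((l u - c)^-1) * ((u - i c * x) + i (-1) * (u - i (l u) * x)).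
    have -> : (u - i c * x) + i (-1) * (u - i (l u) * x) = i (l u - c) * x.
      by rewrite rmorphN rmorph1 mulN1r opprB addrC addrA subrK -mulrBl -rmorphB.
    by rewrite mulrA -rmorphM mulVf // rmorph1 mul1r.
  by apply: (Amul); apply: Aadd => //; apply: Amul.
exists l; last by apply: uniq; rewrite rmorph1 mul1r subrr.
split=> [u v|c u]; apply: uniq.
  by rewrite rmorphD mulrDl opprD addrACA; apply: Aadd.
by rewrite rmorphM -mulrA -mulrBr; apply: Amul.
Qed.

Lemma linear_form_eq0 (x : F) : (forall l, linear_form l -> l x = 0) -> x = 0.
Proof.
move=> H; apply/eqP; apply: contrapT => /negP/linear_form_separates[l ll lx].
by have := oner_neq0 k; rewrite -lx H // eqxx.
Qed.

(** A Gram-Schmidt process: with [P] the projection onto the family so far, a nonzero remainder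
    [x - P x] is added, and its form is composed with [u - P u] so that it kills the earlier
    vectors. The result replaces a basis, with coordinate forms defined on all of [F]. *)
Lemma dual_family (s : seq F) :
  exists (m : nat) (e : 'I_m -> F) (d : 'I_m -> F -> k),
  [/\ forall j, linear_form (d j),
      forall j j', d j (e j') = (j == j')%:R
    & forall x, x \in s -> x = \sum_j i (d j x) * e j].
Proof.
elim: s => [|x s [m [e [d [dl de ds]]]]].
  by exists 0%N, (fun=> 0), (fun=> fun=> 0); split=> [[]|[]|].
pose P u := \sum_j i (d j u) * e j.
have dP j u : d j (P u) = d j u.
  rewrite linear_form_sum // (bigD1 j) //= (dl j).2 de eqxx mulr1.
  by rewrite big1 ?addr0 // => j' /negPf jj'; rewrite (dl j).2 de eq_sym jj' mulr0.
have PD u v : P (u + v) = P u + P v.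
  by rewrite -big_split; apply: eq_bigr => j _; rewrite (dl j).1 rmorphD mulrDl.
have PZ c u : P (i c * u) = i c * P u.
  by rewrite mulr_sumr; apply: eq_bigr => j _; rewrite (dl j).2 rmorphM mulrA.
have PP u : P (P u) = P u by apply: eq_bigr => j _; rewrite dP.
have PN u : P (- u) = - P u by rewrite -mulN1r -(rmorph1 i) -rmorphN PZ rmorphN rmorph1 mulN1r.
have [Px|Px] := eqVneq (x - P x) 0.
  exists m, e, d; split=> // u; rewrite inE => /predU1P[->|/ds //].
  exact: subr0_eq Px.
have [n nl nx] := linear_form_separates Px.
pose e' (j : 'I_m.+1) := if unlift ord0 j is Some j' then e j' else x - P x.
pose d' (j : 'I_m.+1) u := if unlift ord0 j is Some j' then d j' u else n (u - P u).
have d'E u : \sum_j i (d' j u) * e' j = i (n (u - P u)) * (x - P x) + P u.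
  rewrite big_ord_recl /d' /e' unlift_none; congr (_ + _).
  by apply: eq_bigr => j _; rewrite liftK.
exists m.+1, e', d'; split=> [j|j j'|u].
- rewrite /d'; case: unliftP => [j'|] _; first exact: dl.
  split=> [u v|c u] /=; first by rewrite PD opprD addrACA; apply: nl.1.
  by rewrite PZ -mulrBr; apply: nl.2.
- rewrite /d' /e'; case: (unliftP ord0 j) => [a|] ->; case: (unliftP ord0 j') => [b|] ->.
  + by rewrite de (inj_eq lift_inj).
  + by rewrite (dl a).1 linear_formN // dP subrr.
  + have -> : P (e b) = e b.
      rewrite /P (bigD1 b) //= de eqxx rmorph1 mul1r big1 ?addr0 // => c /negPf cb.
      by rewrite de cb rmorph0 mul0r.
    by rewrite subrr linear_form0.
  + by rewrite eqxx PD PN PP subrr subr0 nx.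
- rewrite d'E inE => /predU1P[->|/ds].
    by rewrite nx rmorph1 mul1r subrK.
  by rewrite -/(P u) => <-; rewrite subrr linear_form0 // rmorph0 mul0r add0r.
Qed.

End LinearForms.

(** * Descent along a simple difference ring *)

Definition rmorph_iter (R : pzRingType) (s : {rmorphism R -> R}) N : {rmorphism R -> R} :=
  iter N (fun t : {rmorphism R -> R} => s \o t : {rmorphism R -> R}) idfun.

Lemma rmorph_iterE (R : pzRingType) (s : {rmorphism R -> R}) N :
  rmorph_iter s N =1 iter N s.
Proof. by move=> r; elim: N => //= N <-. Qed.

Section Bilinear.
Variables (k : fieldType) (R F : comPzRingType).
Variables (i : {rmorphism k -> R}) (j : {rmorphism k -> F}).
Implicit Type l : seq (R * F).

(** Both conditions say that a tensor is zero, seen from either factor. Contracting both factors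
    gives the same scalar in either order, and forms separate points. *)
Lemma pairing_swap l :
  (forall d, linear_form j d -> \sum_(p <- l) p.1 * i (d p.2) = 0) ->
  forall d, linear_form i d -> \sum_(p <- l) j (d p.1) * p.2 = 0.
Proof.
move=> H d ld; apply: (@linear_form_eq0 _ _ j) => d' ld'.
rewrite (linear_form_sum ld') (eq_bigr (fun p => d (p.1 * i (d' p.2)))).
  by rewrite -(linear_form_sum ld) H // (linear_form0 ld).
by move=> p _; rewrite ld'.2 mulrC [in RHS]mulrC ld.2.
Qed.

(* The hypothesis says that the sum of the [p.1 (x) p.2] is zero in the tensor
   product over [k]. *)
Lemma pairing_eval l (G : comPzRingType)
    (u : {rmorphism R -> G}) (v : {rmorphism F -> G}) :
  (forall c, u (i c) = v (j c)) ->
  (forall d, linear_form j d -> \sum_(p <- l) p.1 * i (d p.2) = 0) ->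
  \sum_(p <- l) u p.1 * v p.2 = 0.
Proof.
move=> uv H.
have [m [e [d [dl _ de]]]] := dual_family j [seq p.2 | p <- l].
rewrite big_seq (eq_bigr (fun p => \sum_a u (p.1 * i (d a p.2)) * v (e a))).
  rewrite -big_seq exchange_big big1 // => a _.
  by rewrite -mulr_suml -rmorph_sum H // rmorph0 mul0r.
move=> p lp; rewrite [in LHS](de _ (map_f _ lp)) rmorph_sum mulr_sumr.
by apply: eq_bigr => a _; rewrite !rmorphM uv mulrA.
Qed.

End Bilinear.

Lemma pairing_eval_left (k : fieldType) (R F G : comPzRingType)
    (i : {rmorphism k -> R}) (j : {rmorphism k -> F}) (l : seq (R * F))
    (u : {rmorphism R -> G}) (v : {rmorphism F -> G}) :
  (forall c, u (i c) = v (j c)) ->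
  (forall d, linear_form i d -> \sum_(p <- l) j (d p.1) * p.2 = 0) ->
  \sum_(p <- l) u p.1 * v p.2 = 0.
Proof.
move=> uv H; have := @pairing_eval _ _ _ j i [seq (p.2, p.1) | p <- l] G v u.
rewrite big_map => E; rewrite -[RHS]E => [|c|d dl] //.
  by apply: eq_bigr => p _; rewrite mulrC.
by rewrite -[RHS](H d dl) big_map; apply: eq_bigr => p _; rewrite mulrC.
Qed.

Section Descent.
Variables (k : fieldType) (R : comNzRingType) (i : {rmorphism k -> R}).
Variable (s : {rmorphism R -> R}).

Definition sigma_simple : Prop := forall I : R -> Prop,
  (forall x y, I x -> I y -> I (x + y)) -> (forall a x, I x -> I (a * x)) ->
  (forall x, I x -> I (s x)) -> forall x, I x -> x <> 0 -> I 1.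

Hypothesis s_simple : sigma_simple.
Hypothesis s_i : forall c, s (i c) = i c.
Hypothesis s_fixed : forall r, s r = r -> exists c, r = i c.
Variables (F : comPzRingType) (u : {rmorphism R -> F}).

(** As in Artin's independence argument, the first coordinates of all solution families form a
    sigma-stable ideal. If it is nonzero, some family has first coordinate 1; its difference with
    its image under [s] solves a shorter system and vanishes by induction. The family is then
    constant, against freeness. *)
Lemma free_descent m (e : 'I_m -> F) :
  (forall c, \sum_a u (i (c a)) * e a = 0 -> forall a, c a = 0) ->
  forall r : 'I_m -> R, (forall N, \sum_a u (iter N s (r a)) * e a = 0) ->
  forall a, r a = 0.
Proof.
elim: m e => [|m IH] e free_e r r0; first by case.
have free_e' c : \sum_a u (i (c a)) * e (lift ord0 a) = 0 -> forall a, c a = 0.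
  move=> c0 a; pose c' a := if unlift ord0 a is Some b then c b else 0.
  have /free_e/(_ (lift ord0 a)) : \sum_a u (i (c' a)) * e a = 0.
    rewrite big_ord_recl /c' unlift_none !rmorph0 mul0r add0r -[RHS]c0.
    by apply: eq_bigr => b _; rewrite liftK.
  by rewrite /c' liftK.
pose N0 (t : 'I_m.+1 -> R) := forall N, \sum_a u (iter N s (t a)) * e a = 0.
pose I x := exists2 t, N0 t & t ord0 = x.
have r00 : r ord0 = 0.
  apply: contrapT => r00; have [|||||t t0 t1] := s_simple (I := I) _ _ _ (x := r ord0).
  - move=> _ _ [t t0 <-] [t' t'0 <-]; exists (fun a => t a + t' a) => // N.
    under eq_bigr do rewrite -(rmorph_iterE s) !rmorphD mulrDl !(rmorph_iterE s).
    by rewrite big_split /= t0 t'0 addr0.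
  - move=> c _ [t t0 <-]; exists (fun a => c * t a) => // N.
    under eq_bigr do rewrite -(rmorph_iterE s) !rmorphM -mulrA !(rmorph_iterE s).
    by rewrite -mulr_sumr t0 mulr0.
  - move=> _ [t t0 <-]; exists (fun a => s (t a)) => // N.
    by under eq_bigr do rewrite -iterSr.
  - by exists r.
  - exact: r00.
  have st a : s (t (lift ord0 a)) = t (lift ord0 a).
    apply/eqP; rewrite -subr_eq0; apply/eqP.
    apply: (IH _ free_e' (fun a => s (t (lift ord0 a)) - t (lift ord0 a))) => N.
    have h : \sum_a u (iter N.+1 s (t a)) * e a - \sum_a u (iter N s (t a)) * e a = 0.
      by rewrite !t0 subrr.
    rewrite -[RHS]h -sumrB [RHS]big_ord_recl t1 -!(rmorph_iterE s) !rmorph1 subrr add0r.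
    by apply: eq_bigr => b _; rewrite -(rmorph_iterE s) rmorphB !rmorphB mulrBl !(rmorph_iterE s) -iterSr.
  have st' a : s (t a) = t a.
    by case: (unliftP ord0 a) => [b|] ->; rewrite ?st // t1 rmorph1.
  have [c tc] := choice (fun a => s_fixed (st' a)).
  have c0 : c ord0 = 0.
    apply: free_e; rewrite -[RHS](t0 0%N).
    by apply: eq_bigr => a _; rewrite /= tc.
  by have := oner_neq0 R; rewrite -t1 tc c0 rmorph0 eqxx.
move=> a; case: (unliftP ord0 a) => [b|] -> //.
apply: (IH _ free_e' (fun b => r (lift ord0 b))) => N.
by rewrite -[RHS](r0 N) big_ord_recl r00 -(rmorph_iterE s) !rmorph0 mul0r add0r.
Qed.

(* A sigma-stable family of relations on [R (x)_k F] killed by the evaluation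
   [r (x) b |-> u r * b] is already zero in [R (x)_k F]: it spans a sigma-ideal
   that does not meet [1 (x) F]. *)
Lemma simple_descent (l : seq (R * F)) :
  (forall N, \sum_(p <- l) u (iter N s p.1) * p.2 = 0) ->
  forall d, linear_form (u \o i) d -> \sum_(p <- l) p.1 * i (d p.2) = 0.
Proof.
move=> l0 d dl.
have [m [e [f [fl fe ef]]]] := dual_family (u \o i : {rmorphism k -> F}) [seq p.2 | p <- l].
have lE p : p \in l -> p.2 = \sum_a u (i (f a p.2)) * e a.
  by move=> lp; exact: ef (map_f _ lp).
(* The coordinates in [R] of the tensor on the free family [e]; [free_descent] kills each of
   them. *)
pose r a := \sum_(p <- l) p.1 * i (f a p.2).
have r0 : forall a, r a = 0.
  apply: (@free_descent _ e) => [c c0 a|N].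
    have := congr1 (f a) c0; rewrite (linear_form_sum (fl a)) (linear_form0 (fl a)).
    rewrite (bigD1 a) //= big1; last first.
      by move=> b ba; rewrite [f a _](fl a).2 fe eq_sym (negPf ba) mulr0.
    by rewrite [f a _](fl a).2 fe eqxx mulr1 addr0.
  have sN c : iter N s (i c) = i c by elim: N => //= N ->.
  rewrite -[RHS](l0 N) [RHS]big_seq.
  rewrite [RHS](eq_bigr (fun p => \sum_a u (iter N s p.1) * (u (i (f a p.2)) * e a))).
    rewrite -big_seq exchange_big; apply: eq_bigr => a _.
    rewrite /r -(rmorph_iterE s) rmorph_sum rmorph_sum mulr_suml; apply: eq_bigr => p _.
    by rewrite (rmorph_iterE s) mulrA -rmorphM -{2}(sN (f a p.2)) -!(rmorph_iterE s) -!rmorphM.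
  by move=> p lp; rewrite {1}(lE p lp) mulr_sumr.
rewrite big_seq (eq_bigr (fun p => \sum_a p.1 * i (f a p.2) * i (d (e a)))).
  rewrite -big_seq exchange_big big1 // => a _.
  by rewrite -mulr_suml -/(r a) r0 mul0r.
move=> p lp; rewrite {1}(lE p lp) (linear_form_sum dl) rmorph_sum mulr_sumr.
by apply: eq_bigr => a _; rewrite [d _]dl.2 rmorphM mulrA.
Qed.

End Descent.

(** * Polynomial expressions *)

Section Expressions.
Variables (F V : Type).

(** The coefficients form a bare type, so that trees can be taken over [K], over the constants, or
    over [unit], where every coefficient is read as 1. *)
Inductive pexp : Type :=
| PConst of F
| PVar of V
| PAdd of pexp & pexp
| PMul of pexp & pexp.

Fixpoint peval (E : pzRingType) (f : F -> E) (x : V -> E) (e : pexp) : E :=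
  match e with
  | PConst c => f c
  | PVar v => x v
  | PAdd e1 e2 => peval f x e1 + peval f x e2
  | PMul e1 e2 => peval f x e1 * peval f x e2
  end.

Lemma eq_peval (E : pzRingType) (f f' : F -> E) (x x' : V -> E) :
  f =1 f' -> x =1 x' -> peval f x =1 peval f' x'.
Proof. by move=> ff' xx'; elim=> //= e1 -> e2 ->. Qed.

Lemma rmorph_peval (E E' : pzRingType) (g : {rmorphism E -> E'}) f x e :
  g (peval f x e) = peval (g \o f) (g \o x) e.
Proof. by elim: e => //= e1 <- e2 <-; rewrite (rmorphD, rmorphM). Qed.

(** The coefficient [c0] plays the zero of the empty sum, which a bare type [F] does not provide. *)
Lemma peval_sum (I : Type) (l : seq I) (h : I -> pexp) (c0 : F) :
  exists e, forall (E : pzRingType) (f : F -> E) (x : V -> E), f c0 = 0 ->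
    peval f x e = \sum_(p <- l) peval f x (h p).
Proof.
exists (foldr (fun p e => PAdd (h p) e) (PConst c0) l) => E f x fc0.
by elim: l => [|p l IH]; rewrite ?big_nil ?big_cons //= IH.
Qed.

End Expressions.

Fixpoint pexp_map (F F' V : Type) (h : F -> F') (e : pexp F V) : pexp F' V :=
  match e with
  | PConst c => PConst V (h c)
  | PVar v => PVar F' v
  | PAdd e1 e2 => PAdd (pexp_map h e1) (pexp_map h e2)
  | PMul e1 e2 => PMul (pexp_map h e1) (pexp_map h e2)
  end.

Lemma peval_map (F F' V : Type) (h : F -> F') (E : pzRingType) (f : F' -> E)
    (x : V -> E) e : peval f x (pexp_map h e) = peval (f \o h) x e.
Proof. by elim: e => //= e1 -> e2 ->. Qed.

(** Each element is written as an expression in the generators and reevaluated at [z]; the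
    hypothesis on relations, applied to a difference of two expressions, makes the value independent
    of the choice. *)
Lemma rmorphism_extension (K : nzRingType) (V : Type) (R E : pzRingType)
    (f : {rmorphism K -> R}) (g : {rmorphism K -> E}) (x : V -> R) (z : V -> E) :
  (forall r, exists e, r = peval f x e) ->
  (forall e, peval f x e = 0 -> peval g z e = 0) ->
  exists h : {rmorphism R -> E}, (forall a, h (f a) = g a) /\ forall v, h (x v) = z v.
Proof.
move=> /choice[ex exE] rel.
have wd e e' : peval f x e = peval f x e' -> peval g z e = peval g z e'.
  move=> ee'; apply: subr0_eq.
  have := rel (PAdd e (PMul (PConst _ (-1)) e')).
  by rewrite /= !rmorphN !rmorph1 !mulN1r ee' subrr; apply.
pose h r := peval g z (ex r).
have hE e : h (peval f x e) = peval g z e by apply: wd; rewrite -exE.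
have hB : zmod_morphism h.
  move=> r r'; have := hE (PAdd (ex r) (PMul (PConst _ (-1)) (ex r'))).
  by rewrite /= !rmorphN !rmorph1 !mulN1r -!exE.
have hM : monoid_morphism h.
  split; first by have := hE (PConst _ 1); rewrite /= !rmorph1.
  by move=> r r'; have := hE (PMul (ex r) (ex r')); rewrite /= -!exE.
pose hb := GRing.isZmodMorphism.Build _ _ h hB.
pose hm := GRing.isMonoidMorphism.Build _ _ h hM.
pose hr : {rmorphism R -> E} := HB.pack h hb hm.
exists hr; split=> [a|v]; first exact: hE (PConst _ a).
exact: hE (PVar _ v).
Qed.

(* The variables [(false, a, b)] and [(true, a, b)] stand for the entries of a
   matrix and of its inverse. *)
Definition mxval (E : Type) n (M M' : 'M[E]_n) (v : bool * 'I_n * 'I_n) : E :=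
  if v.1.1 then M' v.1.2 v.2 else M v.1.2 v.2.

Lemma map_mxval (E E' : Type) n (g : E -> E') (M M' : 'M[E]_n) :
  g \o mxval M M' =1 mxval (map_mx g M) (map_mx g M').
Proof. by move=> [[[] a] b]; rewrite /mxval /= mxE. Qed.

Lemma rmorph_peval_mx (F : Type) (E E' : pzRingType) n (g : {rmorphism E -> E'})
    (f : F -> E) (M M' : 'M[E]_n) e :
  g (peval f (mxval M M') e)
  = peval (g \o f) (mxval (map_mx g M) (map_mx g M')) e.
Proof. by rewrite rmorph_peval; apply: eq_peval => // v; rewrite map_mxval. Qed.

Section Expand.
Variables (K : Type) (n : nat).
Local Notation V := (bool * 'I_n * 'I_n)%type.

(** The comultiplication of GL_n: entries of a product are bilinear, and the inverse of a product
    reverses the order. All coefficients stay with [M]; the factors in [N] have coefficient 1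
    only. *)
Lemma peval_mulmx (e : pexp K V) :
  exists l : seq (pexp K V * pexp unit V), forall (E : comPzRingType) (f : K -> E)
    (M M' N N' : 'M[E]_n),
  peval f (mxval (M *m N) (N' *m M')) e
  = \sum_(p <- l) peval f (mxval M M') p.1 * peval (fun=> 1) (mxval N N') p.2.
Proof.
elim: e => [c|[[b i] j]|e1 [l1 IH1] e2 [l2 IH2]|e1 [l1 IH1] e2 [l2 IH2]].
- exists [:: (PConst _ c, PConst _ tt)] => E f M M' N N'.
  by rewrite big_seq1 /= mulr1.
- exists [seq (PVar K (b, if b then a else i, if b then j else a),
               PVar unit (b, if b then i else a, if b then a else j))
          | a <- enum 'I_n] => E f M M' N N'.
  rewrite big_map big_enum /=; case: b; rewrite /mxval /= mxE //.
  by apply: eq_bigr => a _; rewrite mulrC.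
- exists (l1 ++ l2) => E f M M' N N'.
  by rewrite big_cat /= IH1 IH2.
- exists [seq (PMul p.1 q.1, PMul p.2 q.2) | p <- l1, q <- l2] => E f M M' N N'.
  rewrite big_allpairs_dep /= IH1 IH2 mulr_suml; apply: eq_bigr => p _.
  by rewrite mulr_sumr; apply: eq_bigr => q _; rewrite mulrACA.
Qed.

End Expand.

(** * The Nullstellensatz over an uncountable field *)

Lemma infinite_set_uniq (T : eqType) (S : set T) m : infinite_set S ->
  exists s : seq T, [/\ uniq s, size s = m & forall x, x \in s -> S x].
Proof.
move=> Sinf; elim: m => [|m [s [us ss sS]]]; first by exists [::].
have [x [Sx xs]] : exists x, S x /\ x \notin s.
  apply: contrapT => N; apply: Sinf; apply: (@sub_finite_set _ _ (fun x => x \in s)).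
    by move=> x Sx; apply: contrapT => /negP xs; apply: N; exists x.
  exact: finite_seq.
exists (x :: s); split=> /= [||y]; rewrite ?xs ?ss //.
by rewrite inE => /predU1P[->|/sS].
Qed.

Section Nullstellensatz.
Variables (F : fieldType) (F_closed : alg_closed F).
Hypothesis F_uncountable : ~ countable [set: F].
Variable N : nat.
Local Notation A := {mpoly F[N]}.

Definition mideal (I : A -> Prop) : Prop :=
  [/\ I 0, forall p q, I p -> I q -> I (p + q) & forall a p, I p -> I (a * p)].

Section Ideal.
Variables (I : A -> Prop) (I_ideal : mideal I).

Lemma mideal_sum (T : Type) (l : seq T) (h : T -> A) :
  (forall t, I (h t)) -> I (\sum_(t <- l) h t).
Proof. by case: I_ideal => I0 ID _ Ih; elim/big_ind: _. Qed.

(** Over a closed field [q] is a product of linear factors, each invertible modulo [I] at [x]. They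
    are cancelled one by one until a nonzero constant remains in [I]. *)
Lemma mideal_root (x : A) (q : {poly F}) : q != 0 ->
  (forall c, exists f, I (1 - f * (x - c%:MP))) ->
  I (map_poly (@mpolyC N F) q).[x] -> I 1.
Proof.
move=> + inv; have [I0 ID IM] := I_ideal.
have [d] := ubnP (size q); elim: d q => // d IH q /ltnSE qd q0 Iq.
have [q1|q1] := leqP (size q) 1.
  move: q0 Iq; rewrite (size1_polyC q1) polyC_eq0 map_polyC hornerC => q0 Iq.
  by have := IM (q`_0)^-1%:MP _ Iq; rewrite -mpolyCM mulVf.
have [r /factor_theorem[q' qE]] := F_closed q1.
have q'0 : q' != 0 by apply: contraNneq q0 => q'0; rewrite qE q'0 mul0r.
apply: (IH q') => //.
  by apply: leq_trans qd; rewrite qE size_Mmonic ?monicXsubC // size_XsubC addn2.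
have [f If] := inv r.
set z := _.[x].
have -> : z = z * (1 - f * (x - r%:MP)) + f * (map_poly (@mpolyC N F) q).[x].
  rewrite qE rmorphM hornerM -/z /= rmorphB /= map_polyX map_polyC hornerD hornerN hornerX hornerC.
  by rewrite mulrBr mulr1 [f * (z * _)]mulrCA subrK.
by apply: ID; apply: IM.
Qed.

(** As [msize] is the degree plus one, the [f a] lie in the span of the monomials of degree below
    [d], which are fewer than [m]. *)
Lemma finite_dimensional_relation d m (f : 'I_m -> A) :
  (#|{: 'X_{1..N < d}}| < m)%N -> (forall a, msize (f a) <= d)%N ->
  exists2 v : 'I_m -> F, \sum_a v a *: f a = 0 & exists a, v a != 0.
Proof.
move=> dm fd.
pose M : 'M[F]_(m, #|{: 'X_{1..N < d}}|) := \matrix_(a, b) (f a)@_(enum_val b : 'X_{1..N < d}).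
have : kermx M != 0.
  by rewrite kermx_eq0 /row_free neq_ltn (leq_ltn_trans (rank_leq_col M)).
case/rowV0Pn=> v /sub_kermxP vM v0; exists (v 0).
  apply/mpolyP=> b; rewrite raddf_sum mcoeff0 /=.
  have [bd|bd] := ltnP (mdeg b) d.
    have := congr1 (fun w : 'rV_ _ => w 0 (enum_rank (BMultinom bd))) vM.
    rewrite !mxE => E; rewrite -[RHS]E; apply: eq_bigr => a _.
    by rewrite mcoeffZ mxE enum_rankK.
  rewrite big1 // => a _; rewrite mcoeffZ memN_msupp_eq0 ?mulr0 //.
  by apply: msize_mdeg_ge; apply: leq_trans bd.
apply: contrapT => va; case/eqP: v0; apply/rowP=> a; rewrite mxE.
by apply: contrapT => /eqP va0; apply: va; exists a.
Qed.

(* Otherwise each [x - c] has an inverse [f c] modulo [I]; uncountably many of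
   them have bounded degree, hence satisfy a linear relation, and clearing
   denominators yields a nonzero polynomial in [x] alone in [I]. *)
Lemma mideal_specialize (x : A) : ~ I 1 ->
  exists c, forall f, ~ I (1 - f * (x - c%:MP)).
Proof.
move=> I1; apply: contrapT => Nc.
have inv c : exists f, I (1 - f * (x - c%:MP)).
  apply: contrapT => Nf; apply: Nc; exists c => f If; apply: Nf; by exists f.
have [f fP] := choice inv.
have [d dinf] : exists d, infinite_set (fun c => msize (f c) <= d)%N.
  apply: contrapT => Nd; apply: F_uncountable.
  have -> : (setT : set F) = (\bigcup_(d in setT) (fun c => msize (f c) <= d)%N)%classic.
    by apply/seteqP; split=> // c _; exists (msize (f c)) => //=.
  apply: bigcup_countable => [|d _]; first exact: countableP; apply: finite_set_countable.
  by apply: contrapT => dinf; apply: Nd; exists d.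
pose M := #|{: 'X_{1..N < d}}|.
have [s [us ss sd]] := infinite_set_uniq M.+1 dinf.
pose c (a : 'I_M.+1) := nth 0 s a.
have c_inj : injective c.
  by move=> a b /eqP; rewrite nth_uniq ?ss // => /eqP/val_inj.
have [|v v0 [a va]] := finite_dimensional_relation (f := f \o c) (ltnSn M).
  by move=> a; apply: sd; rewrite mem_nth ?ss.
(* The sum of the [v b *: Q b] is the numerator of the sum of the fractions v_b / (X - c_b). At
   [c a] only the term of index [a] survives, so it is nonzero. *)
pose Q (b : 'I_M.+1) : {poly F} := \prod_(b' | b' != b) ('X - (c b')%:P).
apply: I1; apply: (@mideal_root x (\sum_b v b *: Q b)) => //.
  apply/eqP => /(congr1 (fun q : {poly F} => q.[c a])).
  rewrite horner0 horner_sum (bigD1 a) //= big1 => [|b ba].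
    rewrite addr0 hornerZ => /eqP; rewrite mulf_eq0 (negPf va) horner_prod /=.
    rewrite prodf_seq_eq0 => /hasP[b _ /andP[ba]].
    by rewrite hornerXsubC subr_eq0 (inj_eq c_inj) eq_sym (negPf ba).
  rewrite hornerZ horner_prod (bigD1 a) /= 1?eq_sym //.
  by rewrite hornerXsubC subrr mul0r mulr0.
pose X (b : 'I_M.+1) : A := x - (c b)%:MP.
have QE b : (map_poly (@mpolyC N F) (Q b)).[x] = \prod_(b' | b' != b) X b'.
  rewrite rmorph_prod horner_prod; apply: eq_bigr => b' _.
  by rewrite /= rmorphB /= map_polyX map_polyC hornerD hornerN hornerX hornerC.
(* The terms subtracted on the right add up to the linear relation [v0] times the product of all
   [X b], that is, to zero. *)
have -> : (map_poly (@mpolyC N F) (\sum_b v b *: Q b)).[x]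
    = \sum_b ((v b)%:MP * (map_poly (@mpolyC N F) (Q b)).[x]) * (1 - f (c b) * X b).
  have E0 : \sum_b ((v b)%:MP * (map_poly (@mpolyC N F) (Q b)).[x]) * (f (c b) * X b) = 0.
    have := congr1 (fun p => p * \prod_b X b) v0; rewrite mul0r mulr_suml => E; rewrite -[RHS]E.
    apply: eq_bigr => b _ /=.
    rewrite QE -mul_mpolyC [\prod_b X b](bigD1 b) //= -!mulrA; congr (_ * _).
    by rewrite mulrC -mulrA.
  under [RHS]eq_bigr do rewrite mulrBr mulr1.
  rewrite sumrB E0 subr0 rmorph_sum horner_sum; apply: eq_bigr => b _ /=.
  by rewrite map_polyZ hornerZ.
by apply: mideal_sum => b; have [_ _ IM] := I_ideal; apply: IM; apply: fP.
Qed.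

End Ideal.

(** The polynomials ['X_a - c%:MP] are adjoined one variable at a time; the choice of [c] in
    [mideal_specialize] is exactly what keeps the larger ideal proper. *)
Lemma mideal_specialize_seq (I : A -> Prop) (s : seq 'I_N) : mideal I -> ~ I 1 ->
  exists J : A -> Prop, [/\ mideal J, ~ J 1, forall p, I p -> J p
    & forall a, a \in s -> exists c : F, J ('X_a - c%:MP)].
Proof.
move=> idI I1; elim: s => [|a s [J [idJ J1 IJ Js]]]; first by exists I.
have [c cP] := mideal_specialize idJ 'X_a J1.
have [J0 JD JM] := idJ.
exists (fun p => exists2 g, J g & exists h, p = g + h * ('X_a - c%:MP)).
have sub p : J p -> exists2 g, J g & exists h, p = g + h * ('X_a - c%:MP).
  by move=> Jp; exists p => //; exists 0; rewrite mul0r addr0.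
split=> [|[g Jg [h E]]|p /IJ/sub //|b].
- split; first exact: sub.
    move=> _ _ [g Jg [h ->]] [g' Jg' [h' ->]]; exists (g + g'); first exact: JD.
    by exists (h + h'); rewrite mulrDl addrACA.
  move=> e _ [g Jg [h ->]]; exists (e * g); first exact: JM.
  by exists (e * h); rewrite mulrDr mulrA.
- by apply: (cP h); rewrite E addrK.
- rewrite inE => /predU1P[->|/Js[c' Jc]]; last by exists c'; apply: sub.
  by exists c; exists 0 => //; exists 1; rewrite mul1r add0r.
Qed.

(** Modulo the enlarged ideal every polynomial is congruent to its value at [c]; a nonzero value of
    a member of [I] would be a unit in a proper ideal. *)
Theorem nullstellensatz (I : A -> Prop) : mideal I -> ~ I 1 ->
  exists c : 'I_N -> F, forall p, I p -> p.@[c] = 0.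
Proof.
move=> idI I1; have [J [idJ J1 IJ Js]] := mideal_specialize_seq (enum 'I_N) idI I1.
have [c cP] := choice (fun a => Js a (mem_enum _ a)).
have [J0 JD JM] := idJ.
have Jc p : J (p - (p.@[c])%:MP).
  elim/mpolyind: p => [|e m p _ _ Jp]; first by rewrite meval0 mpolyC0 subrr.
  rewrite mevalD mpolyCD opprD addrACA; apply: (JD) => //.
  rewrite mevalZ mpolyCM -mul_mpolyC -mulrBr; apply: (JM) => {e p Jp}.
  rewrite mpolyXE_id rmorph_prod [X in _ - X]rmorph_prod /=.
  under [X in _ - X]eq_bigr do rewrite rmorphXn /= mevalXU rmorphXn /=.
  elim/big_rec2: _ => [|a p q _ Jpq]; first by rewrite subrr.
  have -> : 'X_a ^+ m a * q - (c a)%:MP ^+ m a * p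
    = ('X_a ^+ m a - (c a)%:MP ^+ m a) * q + (c a)%:MP ^+ m a * (q - p).
    by rewrite mulrBl mulrBr addrA subrK.
  apply: JD; last exact: JM.
  by rewrite subrXX -mulrA mulrC; apply: JM.
exists c => p Ip; apply: contrapT => /eqP p0; apply: J1.
have Jpc : J (p.@[c])%:MP.
  have := JD _ _ (IJ _ Ip) (JM (-1) _ (Jc p)).
  by rewrite mulN1r opprB addrC subrK.
by have := JM (p.@[c])^-1%:MP _ Jpc; rewrite -mpolyCM mulVf.
Qed.

End Nullstellensatz.

(** * Extending an automorphism to a splitting field *)

Lemma irreducible_factor (F : fieldType) (p : {poly F}) : (1 < size p)%N ->
  exists2 q, irreducible_poly q & q %| p.
Proof.
move=> p1; pose P d := `[< exists q : {poly F}, [/\ q %| p, (1 < size q)%N & size q = d] >].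
have exP : exists d, P d by exists (size p); apply/asboolP; exists p; rewrite dvdpp.
case: (ex_minnP exP) => d /asboolP[q [qp q1 qd]] dmin; exists q => //.
have p0 : p != 0 by rewrite -size_poly_gt0 ltnW.
have q0 : q != 0 by rewrite -size_poly_gt0 ltnW.
split=> // r r1 rq; have r0 : r != 0 by apply: contraNneq q0 => r0; rewrite -dvd0p -r0.
rewrite -dvdp_size_eqp // eqn_leq dvdp_leq //= qd; apply: dmin; apply/asboolP.
exists r; split=> //; first exact: dvdp_trans qp.
by rewrite ltn_neqAle eq_sym r1 size_poly_gt0.
Qed.

Definition splits (F : fieldType) (p : {poly F}) : Prop :=
  exists rs : seq F, p %= \prod_(r <- rs) ('X - r%:P).

Lemma splits_dvdp (F : fieldType) (p q : {poly F}) : splits p -> q %| p -> splits q.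
Proof.
move=> [rs prs]; rewrite (eqp_dvdr _ prs) => /dvdp_prod_XsubC[m qm].
by exists (mask m rs).
Qed.

Lemma splits_root (F : fieldType) (p : {poly F}) : splits p -> (1 < size p)%N ->
  exists r, root p r.
Proof.
move=> [[|r rs] prs]; first by rewrite (eqp_size prs) big_nil size_poly1.
by exists r; rewrite (eqp_root prs) big_cons rootM root_XsubC eqxx.
Qed.

Lemma pexp_horner (F : nzRingType) (e : pexp F unit) :
  exists P : {poly F}, forall (E : comNzRingType) (f : {rmorphism F -> E}) x,
    peval f (fun=> x) e = (map_poly f P).[x].
Proof.
elim: e => [c|[]|e1 [P1 H1] e2 [P2 H2]|e1 [P1 H1] e2 [P2 H2]].
- by exists c%:P => E f x; rewrite map_polyC hornerC.
- by exists 'X => E f x; rewrite map_polyX hornerX.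
- by exists (P1 + P2) => E f x /=; rewrite rmorphD hornerD H1 H2.
- by exists (P1 * P2) => E f x /=; rewrite rmorphM hornerM H1 H2.
Qed.

Lemma horner_pexp (F : nzRingType) (P : {poly F}) :
  exists e : pexp F unit, forall (E : comNzRingType) (f : {rmorphism F -> E}) x,
    (map_poly f P).[x] = peval f (fun=> x) e.
Proof.
elim/poly_ind: P => [|P c [e He]].
  by exists (PConst _ 0) => E f x; rewrite map_poly0 horner0 [RHS]rmorph0.
exists (PAdd (PMul e (PVar _ tt)) (PConst _ c)) => E f x /=.
by rewrite rmorphD rmorphM /= map_polyX map_polyC !hornerE He.
Qed.

(** The universal property holds because a polynomial vanishing at [z] is divisible by [q]: if it
    were coprime to [q], Bezout would give 1 = 0 at [z]. *)
Lemma simple_extension (F : fieldType) (q : {poly F}) : irreducible_poly q ->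
  exists (L : fieldType) (f : {rmorphism F -> L}) (z : L),
  [/\ root (map_poly f q) z, forall x, exists P, x = (map_poly f P).[z]
    & forall (E : fieldType) (g : {rmorphism F -> E}) b, root (map_poly g q) b ->
      exists h : {rmorphism L -> E}, (forall a, h (f a) = g a) /\ h z = b].
Proof.
move=> irq; have [L _ [z qz zL]] := irredp_FAdjoin irq.
have gen (x : L) : exists P, x = (map_poly (in_alg L) P).[z].
  have : x \in <<1; z>>%VS by rewrite zL memvf.
  case/Fadjoin_polyP => P /polyOverP P1 ->.
  have /choice[c cP] a : exists c, P`_a = in_alg L c.
    by have /vlineP[c ->] := P1 a; exists c.
  exists (\poly_(a < size P) c a); congr (_.[_]); apply/polyP => a.
  rewrite coef_map coef_poly /=; case: ltnP => [_|Pa]; first exact: cP.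
  by rewrite nth_default // scale0r.
exists L, (in_alg L), z; split=> // E g b qb.
have [||h [hf hz]] := @rmorphism_extension F unit L E (in_alg L) g (fun=> z) (fun=> b).
- by move=> x; have [P ->] := gen x; have [e eP] := horner_pexp P; exists e; apply: eP.
- move=> e; have [P eP] := pexp_horner e; rewrite !eP => /eqP Pz; apply/eqP.
  have [/dvdpP[r ->]|nqP] := boolP (q %| P).
    by rewrite rmorphM hornerM (eqP qb) mulr0.
  have /Bezout_eq1_coprimepP[[u v] /= uv] : coprimep q P.
    apply: contraNT nqP => /irq.2/(_ (dvdp_gcdl q P)) gq.
    by rewrite -(eqp_dvdl P gq) dvdp_gcdr.
  have /eqP := congr1 (fun p => (map_poly (in_alg L) p).[z]) uv.
  rewrite rmorphD !rmorphM rmorph1 !hornerE (eqP qz) (eqP Pz) !mulr0 addr0.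
  by rewrite eq_sym oner_eq0.
by exists h; split=> //; apply: (hz tt).
Qed.

Definition divring_generated (L : fieldType) (G : L -> Prop) : Prop :=
  forall S : {pred L}, divring_closed S -> (forall x, G x -> x \in S) ->
  forall x, x \in S.

Lemma divring_horner (L : fieldType) (S : {pred L}) (P : {poly L}) x :
  divring_closed S -> (forall a, P`_a \in S) -> x \in S -> P.[x] \in S.
Proof.
move=> Sc PS xS; pose Sm := GRing.isDivringClosed.Build L S Sc.
pose S' : divringClosed L := HB.pack S Sm.
by apply: (@rpred_horner _ S'); first exact/polyOverP.
Qed.

(* The last clause is the universal property that lets automorphisms of [F]
   fixing [p] extend to [L]. *)
Lemma splitting_field (F : fieldType) (p : {poly F}) : p != 0 ->
  exists (L : fieldType) (f : {rmorphism F -> L}),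
  [/\ splits (map_poly f p),
      divring_generated (fun x => (exists a, x = f a) \/ root (map_poly f p) x)
    & forall (E : fieldType) (g : {rmorphism F -> E}), splits (map_poly g p) ->
      exists h : {rmorphism L -> E}, forall a, h (f a) = g a].
Proof.
have [d] := ubnP (size p); elim: d F p => // d IH F p /ltnSE pd p0.
have [p1|p1] := leqP (size p) 1.
  exists F, idfun; split=> [|S _ SF x|E g _]; last by exists g.
    exists [::]; rewrite big_nil map_poly_id // -size_poly_eq1 eqn_leq p1.
    by rewrite size_poly_gt0.
  by apply: SF; left; exists x.
(* One root [z] of [q] is adjoined and the cofactor [p'] of ['X - z%:P] is split over the result. A
   field splitting [p] receives the first step through a root of [q], and the second because [p']
   divides the image of [p]. *)
have [q irq qp] := irreducible_factor p1.
have [L1 [f1 [z [qz gen1 univ1]]]] := simple_extension irq.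
have pz : root (map_poly f1 p) z.
  by move: qz; rewrite -!dvdp_XsubCl => /dvdp_trans; apply; rewrite dvdp_map.
have [p' pE] := factor_theorem _ _ pz.
have p'0 : p' != 0.
  by apply: contraNneq p0 => p'0; rewrite -(map_poly_eq0 f1) pE p'0 mul0r.
have sp' : (size p' < d)%N.
  by apply: leq_trans pd; rewrite -(size_map_poly f1) pE size_Mmonic ?monicXsubC // size_XsubC addn2.
have [L [f2 [spl gen2 univ2]]] := IH _ _ sp' p'0.
have mapE : map_poly (f2 \o f1) p = map_poly f2 p' * ('X - (f2 z)%:P).
  by rewrite map_poly_comp pE rmorphM /= rmorphB /= map_polyX map_polyC.
exists L, (f2 \o f1); split=> [|S Sc SF|E g pg].
- have [rs prs] := spl; exists (f2 z :: rs).
  by rewrite mapE big_cons mulrC eqp_mull.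
- apply: (gen2 S Sc) => x [[y ->]|px]; last first.
    by apply: SF; right; rewrite mapE rootM px.
  have [P ->] := gen1 y; rewrite -horner_map -map_poly_comp.
  apply: divring_horner => // [a|]; first by apply: SF; left; exists P`_a; rewrite coef_map.
  by apply: SF; right; rewrite mapE rootM root_XsubC eqxx orbT.
have [b qb] : exists b, root (map_poly g q) b.
  apply: splits_root; last by rewrite size_map_poly; case: irq.
  by apply: splits_dvdp pg _; rewrite dvdp_map.
have [h1 [h1f h1z]] := univ1 _ _ _ qb.
have [h hf2] : exists h : {rmorphism L -> E}, forall a, h (f2 a) = h1 a.
  apply: univ2; apply: splits_dvdp pg _.
  have -> : map_poly g p = map_poly h1 (map_poly f1 p).
    by rewrite -map_poly_comp; apply: eq_map_poly => a; rewrite /= h1f.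
  by rewrite dvdp_map pE dvdp_mulr.
by exists h => a; rewrite /= hf2.
Qed.

Lemma injective_surjective_bijective (T : Type) (f : T -> T) :
  injective f -> (forall y, exists x, f x = y) -> bijective f.
Proof.
by move=> finj /choice[g gP]; exists g => // x; apply: finj; rewrite gP.
Qed.

Section SplittingDiffField.
Variables (U : diffField) (p : {poly U}).
Hypotheses (p_sigma : map_poly dsigma p = p) (p1 : (1 < size p)%N).

(** As sigma fixes [p], the universal property of the splitting field extends sigma to an
    endomorphism. It permutes the finitely many roots, so its image contains all generators and it
    is an automorphism. *)
Lemma constant_poly_root_extension :
  exists (E : diffField) (f : {rmorphism U -> E}),
    diff_morph f /\ exists x, root (map_poly f p) x.
Proof.
have p0 : p != 0 by rewrite -size_poly_gt0 ltnW.
have [L [f [spl gen univ]]] := splitting_field p0.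
have [s sf] : exists s : {rmorphism L -> L}, forall a, s (f a) = (f \o dsigma) a.
  by apply: univ; rewrite map_poly_comp p_sigma.
have [rs prs] := spl.
have rsE x : root (map_poly f p) x = (x \in undup rs).
  by rewrite (eqp_root prs) root_prod_XsubC mem_undup.
have s_root x : x \in undup rs -> s x \in undup rs.
  rewrite -!rsE => /(rmorph_root s); rewrite -map_poly_comp.
  rewrite (@eq_map_poly _ _ _ (f \o dsigma)); last by move=> a; rewrite /= sf.
  by rewrite map_poly_comp p_sigma.
have s_perm : [seq s x | x <- undup rs] =i undup rs.
  apply: (uniq_min_size _ _ _).2; rewrite ?size_map //.
    by rewrite map_inj_uniq ?undup_uniq //; apply: fmorph_inj.
  by move=> _ /mapP[x xrs ->]; apply: s_root.
have s_bij : bijective s.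
  apply: injective_surjective_bijective; first exact: fmorph_inj.
  have := gen (fun y => `[< exists x, s x = y >]).
  move=> H y; apply/asboolP; apply: (H _ _ y) => [|x [[a ->]|]].
  - split; first by apply/asboolP; exists 1; rewrite rmorph1.
      by move=> _ _ /asboolP[x <-] /asboolP[x' <-]; apply/asboolP; exists (x - x'); rewrite rmorphB.
    by move=> _ _ /asboolP[x <-] /asboolP[x' <-]; apply/asboolP; exists (x / x'); rewrite fmorph_div.
  - apply/asboolP; have [t _ tK] := dsigma_bij U.
    by exists (f (t a)); rewrite sf /= tK.
  - by rewrite rsE -s_perm => /mapP[x' _ ->]; apply/asboolP; exists x'.
have L0 : [pchar L] =i pred0.
  by move=> q; rewrite (fmorph_pchar f) dfield_char0.
exists (DiffField s_bij L0), f; split=> [a|]; first by rewrite /= sf.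
by apply: splits_root => //; rewrite size_map_poly.
Qed.

End SplittingDiffField.

(** * Periodic elements of a generic difference field *)

Lemma horner_dpoly (U : nzRingType) (P : {poly U}) :
  exists e : dpoly U 'I_1, forall (E : diffField) (f : {rmorphism U -> E}) x,
    deval f x e = (map_poly f P).[x ord0].
Proof.
elim/poly_ind: P => [|P c [e He]].
  by exists (DConst _ 0) => E f x; rewrite map_poly0 horner0 [LHS]rmorph0.
exists (DAdd (DMul e (DVar _ ord0)) (DConst _ c)) => E f x /=.
by rewrite rmorphD rmorphM /= map_polyX map_polyC !hornerE He.
Qed.

Lemma iter_fixed_mul (T : Type) (s : T -> T) a m k :
  iter m s a = a -> iter (m * k) s a = a.
Proof. by move=> sa; elim: k => [|k IH]; rewrite ?muln0 // mulnS iterD IH. Qed.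

Section Periodic.
Variable U : diffField.

Definition periodic : {pred U} := fun a => `[< exists2 m, (0 < m)%N & iter m dsigma a = a >].

Lemma periodic_divring : divring_closed periodic.
Proof.
split; first by apply/asboolP; exists 1%N; rewrite //= rmorph1.
- move=> x y /asboolP[m m0 xm] /asboolP[l l0 yl]; apply/asboolP.
  exists (m * l)%N; first by rewrite muln_gt0 m0.
  rewrite -rmorph_iterE rmorphB !rmorph_iterE iter_fixed_mul // mulnC.
  by rewrite iter_fixed_mul.
- move=> x y /asboolP[m m0 xm] /asboolP[l l0 yl]; apply/asboolP.
  exists (m * l)%N; first by rewrite muln_gt0 m0.
  rewrite -rmorph_iterE fmorph_div !rmorph_iterE iter_fixed_mul // mulnC.
  by rewrite iter_fixed_mul.
Qed.

HB.instance Definition _ :=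
  GRing.isDivringClosed.Build U periodic periodic_divring.

Definition periodicField := {a : U | a \in periodic}.

HB.instance Definition _ := SubChoice.on periodicField.
HB.instance Definition _ := [SubChoice_isSubComUnitRing of periodicField by <:].
HB.instance Definition _ := [SubComUnitRing_isSubIntegralDomain of periodicField by <:].
HB.instance Definition _ := [SubIntegralDomain_isSubField of periodicField by <:].

Hypothesis U_generic : generic U.

Lemma constant_poly_root (p : {poly U}) :
  map_poly dsigma p = p -> (1 < size p)%N -> exists x, root p x.
Proof.
move=> ps p1; have [e eP] := horner_dpoly p.
have [|x /(_ ord0) x0] := @U_generic 1%N 1%N (fun=> e).
  have [E [f [fs [x px]]]] := constant_poly_root_extension ps p1.
  exists E, f; split=> //; exists (fun=> x) => _.
  by rewrite eP; apply/eqP.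
exists (x ord0); apply/eqP; rewrite -[RHS]x0 (eP U idfun).
by rewrite map_poly_id.
Qed.

(** The iterates of [x] under sigma are roots of [p]. Among [size p] of them two coincide, and
    injectivity of sigma strips off the smaller exponent. *)
Lemma root_periodic (p : {poly U}) x :
  map_poly dsigma p = p -> p != 0 -> root p x -> x \in periodic.
Proof.
move=> ps p0 px.
have pN N : root p (iter N dsigma x).
  elim: N => //= N /(rmorph_root dsigma); by rewrite ps.
pose rs := [seq iter N dsigma x | N <- iota 0 (size p)].
have : ~~ uniq rs.
  apply/negP => /(max_poly_roots p0); rewrite size_map size_iota ltnn => H.
  by suff: false by []; apply: H; apply/allP => _ /mapP[N _ ->].
case/(uniqPn 0) => a [b [ab]]; rewrite size_map size_iota => bp.
rewrite !(nth_map 0%N) ?size_iota // ?(ltn_trans ab) // !nth_iota ?(ltn_trans ab) //.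
rewrite !add0n -(subnKC (ltnW ab)) iterD -!rmorph_iterE => /fmorph_inj/esym xab.
by apply/asboolP; exists (b - a)%N; rewrite ?subn_gt0 -?rmorph_iterE.
Qed.

(** The coefficients have a common period [m], so the product [P] of the [m] conjugates of the
    polynomial is fixed by sigma and has a root in [U]. That root belongs to some conjugate; moved
    back by the inverse of sigma it becomes a root of the polynomial itself, periodic as a root of
    [P]. *)
Lemma periodic_closed : alg_closed periodicField.
Proof.
move=> p p1; pose q : {poly U} := map_poly val p.
have q1 : (1 < size q)%N by rewrite size_map_poly.
have [m m0 qm] : exists2 m, (0 < m)%N & map_poly (iter m dsigma) q = q.
  have [m m0 mP] : exists2 m, (0 < m)%N & forall a, a \in (q : seq U) -> iter m dsigma a = a.
    have : {subset (q : seq U) <= periodic}.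
      move=> a /(nthP 0)[b _ <-]; rewrite coef_map; exact: valP.
    elim: (q : seq U) => [|a s IH] sP; first by exists 1%N.
    have [|m m0 ms] := IH; first by move=> b bs; apply: sP; rewrite inE bs orbT.
    have /asboolP[l l0 al] := sP a (mem_head _ _).
    exists (m * l)%N; first by rewrite muln_gt0 m0.
    move=> b; rewrite inE => /predU1P[->|/ms bm]; last exact: iter_fixed_mul.
    by rewrite mulnC iter_fixed_mul.
  exists m => //; apply/polyP => a; rewrite coef_map_id0; last first.
    by rewrite -rmorph_iterE rmorph0.
  have [aq|aq] := ltnP a (size q); first by apply: mP; rewrite mem_nth.
  by rewrite nth_default // -rmorph_iterE rmorph0.
pose qs l := map_poly (rmorph_iter dsigma l) q.
pose P := \prod_(l < m) qs l.
have qs0 l : qs l != 0 by rewrite map_poly_eq0 -size_poly_gt0 ltnW.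
have Ps : map_poly dsigma P = P.
  rewrite /P rmorph_prod -(prednK m0) big_ord_recr big_ord_recl mulrC /=; congr (_ * _).
    by apply: eq_bigr => l _; rewrite /qs -map_poly_comp.
  rewrite /qs -map_poly_comp [RHS]map_poly_id // -[RHS]qm -[in RHS](prednK m0).
  by apply: eq_map_poly => a; rewrite /= rmorph_iterE.
have P0 : P != 0 by apply/prodf_neq0 => l _.
have qP : q %| P.
  have -> : q = qs 0%N by rewrite /qs map_poly_id.
  by rewrite /P (bigD1 (Ordinal m0)) //= dvdp_mulr.
have P1 : (1 < size P)%N by apply: leq_trans q1 (dvdp_leq P0 qP).
have [x] := constant_poly_root Ps P1.
rewrite /root horner_prod prodf_seq_eq0 => /hasP[l _ /= /eqP xl].
have [t _ tK] := dsigma_bij U.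
have tlK : iter l dsigma (iter l t x) = x.
  by elim: (l : nat) => // N IH; rewrite iterSr iterS tK.
set y := iter l t x in tlK.
have qy : root q y.
  by rewrite -(fmorph_root (rmorph_iter dsigma l)) rmorph_iterE tlK; apply/eqP.
have yU : y \in periodic.
  by apply: (root_periodic Ps P0); move: qy; rewrite -!dvdp_XsubCl => /dvdp_trans; apply.
pose z : periodicField := exist _ y yU; exists z.
have := fmorph_root (val : {rmorphism periodicField -> U}) p z.
by rewrite -/q [root q _]qy => /esym.
Qed.

End Periodic.

(** * Uncountably many constants *)

Lemma fractionE (D : idomainType) (x : {fraction D}) :
  exists a b, b != 0 /\ x = tofrac a / tofrac b.
Proof.
elim/quotW: x => r; exists (frac r).1, (frac r).2; have r0 := denom_ratioP r; split=> //.
apply: (mulIf (x := tofrac (frac r).2)); first by rewrite tofrac_eq0.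
rewrite divfK ?tofrac_eq0 //; unlock tofrac; rewrite -[LHS]FracField.pi_mul.
apply/eqmodP; rewrite /= FracField.equivfE /FracField.mulf.
by rewrite !numden_Ratio ?oner_eq0 ?mulf_neq0 ?oner_eq0 //= !mulr1 mulrC.
Qed.

Lemma fraction_extension (D : idomainType) (L : fieldType) (f : {rmorphism D -> L}) :
  injective f -> exists g : {rmorphism {fraction D} -> L}, forall a, g (tofrac a) = f a.
Proof.
move=> finj.
have f0 a : (f a == 0) = (a == 0) by rewrite -(inj_eq finj) rmorph0.
have /choice[n /choice[d nd]] := @fractionE D.
pose g x := f (n x) / f (d x).
have gE a b : b != 0 -> g (tofrac a / tofrac b) = f a / f b.
  move=> b0; have := nd (tofrac a / tofrac b).
  rewrite /g; set a' := n _; set b' := d _; move=> [b'0 /eqP].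
  rewrite eqr_div ?tofrac_eq0 // -!tofracM tofrac_eq => /eqP ab.
  by apply/eqP; rewrite eqr_div ?f0 // -!rmorphM ab.
have gF a : g (tofrac a) = f a.
  by rewrite -[tofrac a]divr1 -tofrac1 gE ?oner_eq0 // rmorph1 divr1.
have gB : zmod_morphism g.
  move=> x y; have [[dx ->] [dy ->]] := (nd x, nd y).
  rewrite -mulNr addf_div ?tofrac_eq0 // -tofracN -!tofracM -tofracD.
  by rewrite !gE ?mulf_neq0 // -mulNr addf_div ?f0 // rmorphD !rmorphM rmorphN.
have gM : monoid_morphism g.
  split=> [|x y]; first by rewrite -tofrac1 gF rmorph1.
  have [[dx ->] [dy ->]] := (nd x, nd y).
  rewrite mulf_div -!tofracM.
  by rewrite !gE ?mulf_neq0 // mulf_div !rmorphM.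
pose gb := GRing.isZmodMorphism.Build _ _ g gB.
pose gm := GRing.isMonoidMorphism.Build _ _ g gM.
pose gr : {rmorphism {fraction D} -> L} := HB.pack g gb gm.
by exists gr.
Qed.

Section ConstantExtension.
Variable U : diffField.

(** The field U(X) with sigma acting on coefficients and fixing X. *)
Lemma transcendental_constant_extension :
  exists (E : diffField) (f : {rmorphism U -> E}),
    diff_morph f /\ exists2 t, dsigma t = t & forall a, t != f a.
Proof.
pose T : {rmorphism {poly U} -> {fraction {poly U}}} := @tofrac {poly U}.
pose f : {rmorphism U -> {fraction {poly U}}} := T \o polyC.
have [s sE] : exists s : {rmorphism {fraction {poly U}} -> {fraction {poly U}}},
    forall p, s (T p) = (T \o map_poly dsigma) p.
  apply: fraction_extension => p q /eqP; rewrite /= tofrac_eq => /eqP.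
  exact: map_poly_inj.
have s_bij : bijective s.
  apply: injective_surjective_bijective; first exact: fmorph_inj.
  have [t _ tK] := dsigma_bij U.
  have sT p : s (T (map_poly t p)) = T p.
    by rewrite sE /= (map_polyK tK) ?rmorph0.
  move=> y; have [a [b [b0 ->]]] := fractionE y.
  by exists (T (map_poly t a) / T (map_poly t b)); rewrite fmorph_div !sT.
have E0 : [pchar {fraction {poly U}}] =i pred0.
  by move=> q; rewrite (fmorph_pchar f) dfield_char0.
exists (DiffField s_bij E0), f; split=> [a|].
  by rewrite /= [RHS]sE /= map_polyC.
exists (T 'X); first by rewrite /= [LHS]sE /= map_polyX.
move=> a; rewrite /= tofrac_eq; apply/eqP => /(congr1 (fun p : {poly U} => size p)).
by rewrite size_polyX size_polyC; case: (_ != 0).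
Qed.

Variable kappa : Type.
Hypothesis U_sat : large_systems kappa U.
Hypothesis kappa_uncountable : infinite_set [set: kappa] /\ ~ countable [set: kappa].

(** If the constants were countable, a system of size below [kappa] could ask for a constant
    different from each of them; it is solved by the indeterminate of U(X), hence in [U]. *)
Lemma constants_uncountable : ~ countable [set: constField U].
Proof.
move=> /countable_injP[h hinj].
pose C := constField U.
have C_small : smaller (option C) kappa.
  have Cc : countable [set: option C].
    apply/countable_injP; exists (fun o => if o is Some a then (h a).+1 else 0%N).
    move=> [a|] [b|] _ _ //= [] ab; congr Some; apply: hinj => //; exact: in_setT.
  split; last by move=> kC; apply: kappa_uncountable.2; apply: card_le_trans kC Cc.
  by apply: card_le_trans Cc _; apply/infiniteP; exact: kappa_uncountable.1.
(* The variable [None] is the new constant; the variable [Some a] is an inverse of its difference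
   with [a], which turns an inequation into an equation. *)
pose S (o : option C) : dpoly U (option C) :=
  if o is Some a
  then DAdd (DMul (DVar _ o) (DAdd (DVar _ None) (DConst _ (- val a)))) (DConst _ (-1))
  else DAdd (DSigma (DVar _ None)) (DMul (DConst _ (-1)) (DVar _ None)).
have [|x xS] := U_sat (S := S) C_small C_small.
  have [E [f [fs [t ts tf]]]] := transcendental_constant_extension.
  exists E, f; split=> //.
  exists (fun o => if o is Some a then (t - f (val a))^-1 else t) => -[a|] /=.
    by rewrite !rmorphN rmorph1 mulVf ?subrr // subr_eq0.
  by rewrite ts rmorphN rmorph1 mulN1r subrr.
have xC : x None \in constants U.
  have /= := xS None; rewrite mulN1r => /eqP; rewrite subr_eq0 => /eqP xs.
  by apply/eqP.
have := xS (Some (exist _ (x None) xC)).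
by rewrite /= subrr mulr0 add0r => /eqP; rewrite oppr_eq0 oner_eq0.
Qed.

End ConstantExtension.

(** * Solving relations with constant coefficients by periodic elements *)

Section ConstantPoints.
Variables (U : diffField).
Hypotheses (U_generic : generic U) (C_uncountable : ~ countable [set: constField U]).

Lemma constants_periodic (a : constField U) : val a \in @periodic U.
Proof. by apply/asboolP; exists 1%N => //=; exact/eqP/(valP a). Qed.

Let incl (a : constField U) : periodicField U := exist _ (val a) (constants_periodic a).

Lemma periodic_uncountable : ~ countable [set: periodicField U].
Proof.
move=> /countable_injP[h hinj]; apply: C_uncountable; apply/countable_injP.
exists (h \o incl) => a b _ _ /= hab; apply: val_inj.
have /(congr1 val) // : incl a = incl b.
by apply: hinj; rewrite ?in_setT.
Qed.

(** The relations of [z] over the periodic field form a proper ideal, because [E] is nonzero, and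
    the Nullstellensatz gives a zero. Its coordinates are periodic, while only relations over the
    constants are retained. *)
Lemma constant_point_nz (V : finType) (E : comNzRingType) (g : {rmorphism U -> E})
    (z : V -> E) :
  exists c : V -> U, forall e : pexp (constField U) V,
    peval (g \o val) z e = 0 -> peval val c e = 0.
Proof.
pose w : {rmorphism periodicField U -> E} := g \o val.
pose ev := mmap w (z \o @enum_val V predT).
have [||c cP] := @nullstellensatz _ (periodic_closed U_generic) periodic_uncountable _
  (fun q => ev q = 0).
- split=> [|p q p0 q0|a p p0]; first by rewrite [LHS]rmorph0.
    by rewrite [LHS]rmorphD /= [X in X + _]p0 [X in _ + X]q0 addr0.
  by rewrite [LHS]rmorphM /= [X in _ * X]p0 mulr0.
- by rewrite [X in X = _]rmorph1 => /eqP; rewrite oner_eq0.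
exists (fun v => val (c (enum_rank v))) => e e0.
pose q : {mpoly (periodicField U)[#|V|]} :=
  peval (@mpolyC _ _ \o incl) (fun v => 'X_(enum_rank v)) e.
have /cP/(congr1 val) : ev q = 0.
  rewrite /ev rmorph_peval -[RHS]e0; apply: eq_peval => a.
    exact: (mmapC _ w (incl a)).
  by rewrite [LHS]mmapX mmap1U /= enum_rankK.
rewrite rmorph_peval [val 0]rmorph0 rmorph_peval => <-; apply: eq_peval => a /=.
  by rewrite mevalC.
by rewrite mevalXU.
Qed.

Lemma constant_point (V : finType) (E : comPzRingType) (g : {rmorphism U -> E})
    (z : V -> E) : 1 != 0 :> E ->
  exists c : V -> U, forall e : pexp (constField U) V,
    peval (g \o val) z e = 0 -> peval val c e = 0.
Proof.
move=> E1; pose Enz := GRing.PzSemiRing_isNonZero.Build E E1.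
pose E' : comNzRingType := HB.pack (E : Type) E Enz.
exact: (@constant_point_nz V E' g z).
Qed.

End ConstantPoints.

(** * Tensor products over a field *)

Section TensorOverField.
Variables (k : fieldType) (R B : comNzRingType).
Variables (i : {rmorphism k -> R}) (j : {rmorphism k -> B}).
Local Notation T := (tensor i j).

Definition tensor_inl (r : R) : T := pure i j r 1.
Definition tensor_inr (b : B) : T := pure i j 1 b.

Lemma tensor_inl_zmod : zmod_morphism tensor_inl.
Proof.
move=> x y; have p := pure_balanced i j.
apply: (addIr (tensor_inl y)); rewrite subrK -[LHS]/(tensor_inl _ + tensor_inl _).
by rewrite /tensor_inl -(balanced_addl p) subrK.
Qed.

Lemma tensor_inl_monoid : monoid_morphism tensor_inl.
Proof. by split=> // x y; rewrite /tensor_inl pure_mul mulr1. Qed.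

HB.instance Definition _ := GRing.isZmodMorphism.Build R T tensor_inl tensor_inl_zmod.
HB.instance Definition _ := GRing.isMonoidMorphism.Build R T tensor_inl tensor_inl_monoid.

Lemma tensor_inr_zmod : zmod_morphism tensor_inr.
Proof.
move=> x y; have p := pure_balanced i j.
apply: (addIr (tensor_inr y)); rewrite subrK -[LHS]/(tensor_inr _ + tensor_inr _).
by rewrite /tensor_inr -(balanced_addr p) subrK.
Qed.

Lemma tensor_inr_monoid : monoid_morphism tensor_inr.
Proof. by split=> // x y; rewrite /tensor_inr pure_mul mulr1. Qed.

HB.instance Definition _ := GRing.isZmodMorphism.Build B T tensor_inr tensor_inr_zmod.
HB.instance Definition _ := GRing.isMonoidMorphism.Build B T tensor_inr tensor_inr_monoid.

Lemma tensor_inlr r b : tensor_inl r * tensor_inr b = pure i j r b.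
Proof. by rewrite [LHS]pure_mul mulr1 mul1r. Qed.

Lemma tensor_in_scalar c : tensor_inl (i c) = tensor_inr (j c).
Proof.
by have := balanced_scale (pure_balanced i j) c 1 1; rewrite !mulr1.
Qed.

Definition slice (d : B -> k) : T -> R := tensor_lift (fun r b => r * i (d b)).

Lemma slice_balanced d : linear_form j d -> balanced i j (fun r b => r * i (d b)).
Proof.
move=> dl; split=> [b x y|r x y|c r b]; first by rewrite mulrDl.
  by rewrite dl.1 rmorphD mulrDr.
by rewrite dl.2 rmorphM mulrA [r * _]mulrC.
Qed.

Lemma slice_pure d r b : linear_form j d -> slice d (pure i j r b) = r * i (d b).
Proof. by move=> dl; apply/lift_pure/slice_balanced. Qed.

Lemma slice_sum d (I : Type) (l : seq I) (h : I -> T) : linear_form j d ->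
  slice d (\sum_(p <- l) h p) = \sum_(p <- l) slice d (h p).
Proof.
move=> /slice_balanced dl; apply: (big_morph (slice d)).
  by move=> x y; apply: lift_add.
exact: lift_zero.
Qed.

(** A dual family for the second components of a representative recovers the tensor from its slices,
    so properties that descend to slices can be glued back. *)
Lemma tensor_sliceE (x : T) : exists (m : nat) (e : 'I_m -> B) (d : 'I_m -> B -> k),
  (forall a, linear_form j (d a)) /\ x = \sum_a pure i j (slice (d a) x) (e a).
Proof.
have [m [e [d [dl _ de]]]] := dual_family j [seq p.2 | p <- repr x].
exists m, e, d; split=> //.
rewrite {1}[x]tensor_sum_pure big_seq.
rewrite (eq_bigr (fun p => \sum_a pure i j (p.1 * i (d a p.2)) (e a))).
  rewrite -big_seq exchange_big; apply: eq_bigr => a _ /=.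
  rewrite {2}[x]tensor_sum_pure slice_sum // -tensor_inlr rmorph_sum mulr_suml.
  by apply: eq_bigr => p _; rewrite slice_pure // tensor_inlr.
move=> p xp; rewrite {1}(de p.2 (map_f _ xp)) -tensor_inlr rmorph_sum mulr_sumr.
apply: eq_bigr => a _; rewrite rmorphM /= -tensor_in_scalar mulrA.
by rewrite -rmorphM tensor_inlr.
Qed.

Lemma tensor_oner_neq0 : 1 != 0 :> T.
Proof.
have [d dl d1] := linear_form_separates j (oner_neq0 B).
apply/eqP => /(congr1 (slice d)); rewrite [LHS]slice_pure // d1 rmorph1 mulr1.
rewrite [RHS](lift_zero (slice_balanced dl)) => /eqP.
by rewrite oner_eq0.
Qed.

(** A form [d] on [R] with value 1 at 1 yields the left inverse sending the tensor of r and b to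
    d(r) b. *)
Lemma tensor_inr_inj : injective tensor_inr.
Proof.
have [d dl d1] := linear_form_separates i (oner_neq0 R).
have bal : balanced i j (fun r b => j (d r) * b).
  split=> [b x y|r x y|c r b]; first by rewrite dl.1 rmorphD mulrDl.
    by rewrite mulrDr.
  by rewrite dl.2 rmorphM [RHS]mulrCA mulrA.
move=> b b' /(congr1 (tensor_lift (fun r b => j (d r) * b))).
by rewrite !lift_pure // d1 rmorph1 !mul1r.
Qed.

Section Universal.
Variable S : comPzRingType.

Lemma tensor_rmorphism (u : {rmorphism R -> S}) (v : {rmorphism B -> S}) :
  (forall c, u (i c) = v (j c)) ->
  exists h : {rmorphism T -> S}, h =1 tensor_lift (fun r b => u r * v b).
Proof.
move=> uv; set h := tensor_lift _.
have bal : balanced i j (fun r b => u r * v b).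
  split=> [b x y|r x y|c r b]; first by rewrite rmorphD mulrDl.
    by rewrite rmorphD mulrDr.
  by rewrite !rmorphM uv [RHS]mulrCA mulrA.
have hB : zmod_morphism h.
  by move=> x y; rewrite /h -[x - y]/(tensor_add x (tensor_opp y)) lift_add // lift_opp.
have hM : monoid_morphism h.
  split=> [|x y]; first by rewrite [LHS]lift_pure // !rmorph1 mulr1.
  rewrite /h [x * y]/(tensor_mul x y) lift_mul // /tensor_lift /formal_eval mulr_suml.
  by apply: eq_bigr => p _; rewrite mulr_sumr; apply: eq_bigr => q _; rewrite !rmorphM mulrACA.
pose hb := GRing.isZmodMorphism.Build _ _ h hB.
pose hm := GRing.isMonoidMorphism.Build _ _ h hM.
pose hr : {rmorphism T -> S} := HB.pack h hb hm.
by exists hr.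
Qed.

Lemma tensor_rmorphism_pure (u : {rmorphism R -> S}) (v : {rmorphism B -> S}) :
  (forall c, u (i c) = v (j c)) ->
  exists h : {rmorphism T -> S},
    (forall r, h (tensor_inl r) = u r) /\ (forall b, h (tensor_inr b) = v b).
Proof.
move=> uv; have [h hE] := tensor_rmorphism uv; exists h.
have bal : balanced i j (fun r b => u r * v b).
  split=> [b x y|r x y|c r b]; first by rewrite rmorphD mulrDl.
    by rewrite rmorphD mulrDr.
  by rewrite !rmorphM uv [RHS]mulrCA mulrA.
by split=> x; rewrite hE [LHS]lift_pure // rmorph1 (mulr1, mul1r).
Qed.

Lemma tensor_rmorphism_ext (h h' : {rmorphism T -> S}) :
  (forall r, h (tensor_inl r) = h' (tensor_inl r)) ->
  (forall b, h (tensor_inr b) = h' (tensor_inr b)) -> h =1 h'.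
Proof.
move=> hl hr x; rewrite [x]tensor_sum_pure !rmorph_sum; apply: eq_bigr => p _.
by rewrite -tensor_inlr !rmorphM hl hr.
Qed.

End Universal.

End TensorOverField.

(** * Regular functions on a subset of GL_m *)

Lemma rmorph_mx_eval (k B B' : comNzRingType) (j : {rmorphism k -> B})
    (j' : {rmorphism k -> B'}) (u : {rmorphism B -> B'}) m (g : 'M[B]_m) p :
  (forall c, u (j c) = j' c) -> u (mx_eval j g p) = mx_eval j' (map_mx u g) p.
Proof.
move=> uj; rewrite /mx_eval /mmap rmorph_sum; apply: eq_bigr => a _.
rewrite rmorphM uj /mmap1 rmorph_prod; congr (_ * _); apply: eq_bigr => b _.
by rewrite rmorphXn -map_mxvec mxE.
Qed.

Section RegularFunctions.
Variables (U : fieldType) (m : nat).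

(** The base point makes the ring of functions nonzero, as required of the test rings of the group
    functor. *)
Record gl_set := GlSet {
  gl_carrier :> set 'M[U]_m;
  gl_pt : 'M[U]_m;
  gl_ptP : gl_carrier gl_pt;
  gl_unit : forall g, gl_carrier g -> g \in unitmx }.

Variable X : gl_set.

Definition gl_sub := {g : 'M[U]_m | gl_carrier X g}.

Definition det_mpoly : {mpoly U[m * m]} := \det (\matrix_(a, b) 'X_(mxvec_index a b)).

Lemma det_mpolyE g : mx_eval idfun g det_mpoly = \det g.
Proof.
rewrite /mx_eval -det_map_mx; congr (\det _); apply/matrixP => a b.
by rewrite !mxE [LHS]mmapX mmap1U mxvecE.
Qed.

Definition regular : {pred gl_sub -> U} := fun f =>
  `[< exists P e, forall g, f g = mx_eval idfun (sval g) P / \det (sval g) ^+ e >].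

Lemma gl_det_neq0 (g : gl_sub) : \det (sval g) != 0.
Proof. by rewrite -unitfE -unitmxE; apply/gl_unit/(svalP g). Qed.

Lemma regular_subring : subring_closed regular.
Proof.
split.
- apply/asboolP; exists 1, 0%N => g; rewrite expr0 divr1.
  by rewrite [mx_eval _ _ _]rmorph1.
- move=> f f' /asboolP[P [e fP]] /asboolP[P' [e' fP']]; apply/asboolP.
  exists (P * det_mpoly ^+ e' - P' * det_mpoly ^+ e), (e + e')%N => g.
  rewrite [LHS]/GRing.add /= [X in _ + X]/GRing.opp /= fP fP'.
  have d0 := gl_det_neq0 g.
  rewrite -mulNr addf_div ?expf_neq0 // -exprD mulNr; congr (_ / _).
  by rewrite /mx_eval rmorphB !rmorphM !rmorphXn /= -!/(mx_eval _ _ _) !det_mpolyE.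
- move=> f f' /asboolP[P [e fP]] /asboolP[P' [e' fP']]; apply/asboolP.
  exists (P * P'), (e + e')%N => g.
  rewrite [LHS]/GRing.mul /= fP fP' mulf_div -exprD; congr (_ / _).
  by rewrite /mx_eval rmorphM.
Qed.

HB.instance Definition _ := GRing.isSubringClosed.Build (gl_sub -> U) regular regular_subring.

(** The coordinate ring is taken inside the functions on points, so that equality is pointwise and
    nothing about radicals has to be proved. *)
Definition regular_fun := {f : gl_sub -> U | f \in regular}.

HB.instance Definition _ := SubChoice.on regular_fun.
HB.instance Definition _ :=
  GRing.SubChoice_isSubComPzRing.Build (gl_sub -> U) regular regular_fun regular_subring.

Definition regular_at (g : gl_sub) (f : regular_fun) : U := val f g.

Lemma regular_at_zmod g : zmod_morphism (regular_at g).
Proof. by move=> f f'; rewrite /regular_at rmorphB. Qed.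

Lemma regular_at_monoid g : monoid_morphism (regular_at g).
Proof. by split=> [|f f']; rewrite /regular_at ?rmorph1 ?rmorphM. Qed.

Lemma regular_oner_neq0 : 1 != 0 :> regular_fun.
Proof.
apply/eqP => /(congr1 (regular_at (exist _ _ (gl_ptP X)))) /eqP.
by rewrite /regular_at rmorph1 rmorph0 [X in X == _]/(1 : U) oner_eq0.
Qed.

HB.instance Definition _ := GRing.PzSemiRing_isNonZero.Build regular_fun regular_oner_neq0.
HB.instance Definition _ g :=
  GRing.isZmodMorphism.Build regular_fun U (regular_at g) (regular_at_zmod g).
HB.instance Definition _ g :=
  GRing.isMonoidMorphism.Build regular_fun U (regular_at g) (regular_at_monoid g).

Lemma regular_at_inj (f f' : regular_fun) :
  (forall g, regular_at g f = regular_at g f') -> f = f'.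
Proof. by move=> ff'; apply/val_inj/funext. Qed.

Lemma regular_mpoly (P : {mpoly U[m * m]}) e :
  (fun g : gl_sub => mx_eval idfun (sval g) P / \det (sval g) ^+ e) \in regular.
Proof. by apply/asboolP; exists P, e. Qed.

Definition regular_of P e : regular_fun :=
  exist (fun f => f \in regular) _ (regular_mpoly P e).

Definition regular_const (c : U) : regular_fun := regular_of c%:MP 0.

Lemma regular_at_const g c : regular_at g (regular_const c) = c.
Proof. by rewrite /regular_at /= divr1 [mx_eval _ _ _]mmapC. Qed.

Lemma regular_const_zmod : zmod_morphism regular_const.
Proof.
by move=> c d; apply: regular_at_inj => g; rewrite rmorphB /= !regular_at_const.
Qed.

Lemma regular_const_monoid : monoid_morphism regular_const.
Proof.
by split=> [|c d]; apply: regular_at_inj => g;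
  rewrite ?rmorph1 ?rmorphM /= !regular_at_const.
Qed.

HB.instance Definition _ :=
  GRing.isZmodMorphism.Build U regular_fun regular_const regular_const_zmod.
HB.instance Definition _ :=
  GRing.isMonoidMorphism.Build U regular_fun regular_const regular_const_monoid.

(** The tautological point of [X] over its own coordinate ring; every point of [X] is a
    specialization of it. *)
Definition generic_mx : 'M[regular_fun]_m :=
  \matrix_(a, b) regular_of 'X_(mxvec_index a b) 0.

Lemma generic_mxE g : map_mx (regular_at g) generic_mx = sval g.
Proof.
apply/matrixP => a b; rewrite !mxE /regular_at /= divr1 [mx_eval _ _ _]mmapX.
by rewrite mmap1U mxvecE.
Qed.

Lemma generic_mx_det : exists d, \det generic_mx * d = 1.
Proof.
exists (regular_of 1 1); apply: regular_at_inj => g.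
rewrite rmorphM rmorph1 /= -det_map_mx generic_mxE /regular_at /=.
by rewrite [mx_eval _ _ _]rmorph1 expr1 mul1r mulfV ?gl_det_neq0.
Qed.

Lemma generic_mx_points (k : comNzRingType) (j : {rmorphism k -> U}) S :
  (forall g, gl_carrier X g -> gl_points S j g) -> gl_points S (regular_const \o j) generic_mx.
Proof.
move=> XS; split=> [|p Sp]; first exact: generic_mx_det.
apply: regular_at_inj => g; rewrite rmorph0.
rewrite (@rmorph_mx_eval _ _ _ _ j); last by move=> c; apply: regular_at_const.
by rewrite generic_mxE; have [_ ->] := XS _ (svalP g).
Qed.

(** The value 0 outside [X] is a dummy: [regular_on] and [alg_group_isom] constrain the map on [X]
    only. *)
Definition regular_map n (M : 'M[regular_fun]_n) (g : 'M[U]_m) : 'M[U]_n :=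
  if pselect (gl_carrier X g) is left Xg then map_mx (regular_at (exist _ g Xg)) M else 0.

Lemma regular_mapE n (M : 'M[regular_fun]_n) (g : gl_sub) :
  regular_map M (sval g) = map_mx (regular_at g) M.
Proof.
rewrite /regular_map; case: pselect => [Xg|]; last by case; apply: svalP g.
by congr (map_mx (regular_at _) M); case: g Xg => g Xg Xg'; congr exist; apply: Prop_irrelevance.
Qed.

Lemma regular_map_on n (M : 'M[regular_fun]_n) : regular_on X (regular_map M).
Proof.
have /choice[P /choice[e Pe]] (ab : 'I_n * 'I_n) : exists P e, forall g : gl_sub,
    regular_at g (M ab.1 ab.2) = mx_eval idfun (sval g) P / \det (sval g) ^+ e.
  exact/asboolP/(valP (M ab.1 ab.2)).
(* A common exponent of the determinant for all entries; each numerator is multiplied by the missing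
   power. *)
pose E := (\max_ab e ab)%N.
exists (\matrix_(a, b) (P (a, b) * det_mpoly ^+ (E - e (a, b)))), E => g Xg a b.
rewrite -[g]/(sval (exist _ g Xg : gl_sub)) regular_mapE mxE (Pe (a, b)) mxE.
have d0 := gl_det_neq0 (exist _ g Xg); rewrite /= in d0 *.
have -> : \det g ^+ E = \det g ^+ (E - e (a, b)) * \det g ^+ e (a, b).
  by rewrite -exprD subnK // leq_bigmax.
rewrite /mx_eval rmorphM rmorphXn /= -!/(mx_eval _ _ _) det_mpolyE.
by rewrite [X in _ = X / _]mulrC -mulf_div divff ?expf_neq0 // mul1r.
Qed.

End RegularFunctions.

(** * Automorphisms of a base change of the Picard-Vessiot ring *)

Section Galois.
Variables (K : diffField) (R : diffRing) (eta : {rmorphism K -> R}).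
Variables (n : nat) (A : 'M[K]_n) (y y' : 'M[R]_n).
Hypothesis eta_sigma : forall a, eta (dsigma a) = rsigma (eta a).
Hypotheses (yy' : y *m y' = 1%:M) (y'y : y' *m y = 1%:M).
Hypothesis y_sigma : map_mx rsigma y = map_mx eta A *m y.
Hypothesis y_gen : forall r : R, exists e, r = peval eta (mxval y y') e.
Hypothesis newC : no_new_constants eta.

Lemma rmorph_solution_ext (S : comPzRingType) (g g' : {rmorphism R -> S}) :
  (forall a, g (eta a) = g' (eta a)) -> map_mx g y = map_mx g' y -> g =1 g'.
Proof.
move=> geta gy.
have gy' : map_mx g y' = map_mx g' y'.
  rewrite -[LHS]mulmx1 -(map_mx1 g') -yy' map_mxM -gy mulmxA -map_mxM y'y.
  by rewrite map_mx1 mul1mx.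
by move=> r; have [e ->] := y_gen r; rewrite !rmorph_peval_mx gy gy'; apply: eq_peval.
Qed.

Local Notation k := (constField K).
Local Notation i := (const_incl eta).

Lemma const_incl_fixed (c : k) : rsigma (i c) = i c.
Proof. by rewrite /= -eta_sigma (eqP (valP c)). Qed.

Lemma const_incl_onto r : rsigma r = r -> exists c, r = i c.
Proof. by move=> /newC[a aC ->]; exists (exist _ a aC). Qed.

Lemma y'_sigma : map_mx rsigma y' *m map_mx eta A = y'.
Proof.
rewrite -[LHS]mulmx1 -yy' mulmxA -[_ *m _ *m y]mulmxA -y_sigma -map_mxM y'y.
by rewrite map_mx1 mul1mx.
Qed.

Section Points.
Variables (B : comNzRingType) (j : {rmorphism k -> B}).
Local Notation T := (base_change eta j).
Local Notation inl := (tensor_inl i j).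
Local Notation inr := (tensor_inr i j).

Lemma base_sigma_rmorphism : exists bs : {rmorphism T -> T},
  [/\ bs =1 base_sigma (eta := eta) (j := j), forall r, bs (inl r) = inl (rsigma r)
    & forall b, bs (inr b) = inr b].
Proof.
have [c|bs bsE] := @tensor_rmorphism _ _ _ i j T (inl \o rsigma) inr.
  by rewrite /= -[eta (val c)]/(i c) const_incl_fixed tensor_in_scalar.
have bsE' : bs =1 base_sigma (eta := eta) (j := j).
  move=> x; rewrite bsE /base_sigma /tensor_map; congr (tensor_lift _ x).
  by apply/funext => r; apply/funext => b; rewrite /= tensor_inlr.
by exists bs; split=> // x; rewrite bsE' base_sigma_pure // rmorph1.
Qed.

(** Slicing commutes with sigma, so the slices of [t] are fixed elements of [R], hence constants of
    [K]. As scalars they move across the tensor sign. *)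
Lemma base_sigma_fixed (t : T) : base_sigma t = t -> exists b, t = inr b.
Proof.
have [bs [bsE bsl bsr]] := base_sigma_rmorphism; rewrite -bsE => tfix.
have sliceS d : linear_form j d -> rsigma (slice d t) = slice d t.
  move=> dl; rewrite -[in RHS]tfix {tfix}.
  have := tensor_sum_pure t; move: (repr t) => l ->.
  rewrite [bs _]rmorph_sum !slice_sum // [LHS]rmorph_sum; apply: eq_bigr => p _.
  rewrite -tensor_inlr rmorphM bsl bsr !tensor_inlr !slice_pure // rmorphM.
  by rewrite const_incl_fixed.
have [m [e [d [dl tE]]]] := tensor_sliceE t.
have /choice[c cE] a : exists c, slice (d a) t = i c by exact/const_incl_onto/sliceS/dl.
exists (\sum_a j (c a) * e a); rewrite {1}tE rmorph_sum; apply: eq_bigr => a _.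
by rewrite cE -tensor_inlr rmorphM /= -tensor_in_scalar.
Qed.

Section Automorphism.
Variables (f : {rmorphism T -> T}) (f_aut : diff_aut f).

Lemma diff_aut_inl a : f (inl (eta a)) = inl (eta a).
Proof.
by have [_ lin _] := f_aut; have := lin a 1 1; rewrite rmorph1 !mulr1.
Qed.

Lemma diff_aut_inr b : f (inr b) = inr b.
Proof.
by have [_ lin _] := f_aut; have := lin 1 b 1; rewrite !rmorph1 !mulr1.
Qed.

(** Both [y] and its image under [f] solve the same difference system, so the quotient [M] of the
    two is fixed by sigma entry by entry. *)
Lemma diff_aut_matrix :
  exists g : 'M[B]_n, map_mx f (map_mx inl y) = map_mx inl y *m map_mx inr g.
Proof.
have [bs [bsE bsl bsr]] := base_sigma_rmorphism; have [_ _ fs] := f_aut.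
have bsy (z : 'M[R]_n) : map_mx bs (map_mx inl z) = map_mx inl (map_mx rsigma z).
  by apply/matrixP => a b; rewrite !mxE bsl.
pose N := map_mx f (map_mx inl y).
have bsN : map_mx bs N = map_mx inl (map_mx eta A) *m N.
  have -> : map_mx bs N = map_mx f (map_mx inl (map_mx rsigma y)).
    by rewrite -bsy; apply/matrixP => a b; rewrite !mxE !bsE fs.
  rewrite y_sigma !map_mxM; congr (_ *m _).
  by apply/matrixP => a b; rewrite !mxE diff_aut_inl.
pose M := map_mx inl y' *m N.
have bsM : map_mx bs M = M.
  by rewrite map_mxM bsN bsy mulmxA -map_mxM y'_sigma.
have /choice[g gP] (ab : 'I_n * 'I_n) : exists b, M ab.1 ab.2 = inr b.
  apply: base_sigma_fixed; rewrite -bsE.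
  by have := congr1 (fun N : 'M_n => N ab.1 ab.2) bsM; rewrite mxE.
exists (\matrix_(a, b) g (a, b)).
have -> : map_mx inr (\matrix_(a, b) g (a, b)) = M.
  by apply/matrixP => a b; rewrite 2!mxE -gP.
by rewrite mulmxA -map_mxM yy' map_mx1 mul1mx.
Qed.

End Automorphism.

Lemma matrix_inj (g g' : 'M[B]_n) :
  map_mx inl y *m map_mx inr g = map_mx inl y *m map_mx inr g' -> g = g'.
Proof.
move=> /(congr1 (mulmx (map_mx inl y'))).
rewrite !mulmxA -map_mxM y'y map_mx1 !mul1mx => gg'.
apply/matrixP => a b; apply: (@tensor_inr_inj _ _ _ i j).
by have := congr1 (fun M : 'M_n => M a b) gg'; rewrite !mxE.
Qed.

Lemma diff_aut_ext f f' : diff_aut f -> diff_aut f' ->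
  map_mx f (map_mx inl y) = map_mx f' (map_mx inl y) -> f =1 f'.
Proof.
move=> fa fa' ff'; apply: tensor_rmorphism_ext => [r|b]; last by rewrite !diff_aut_inr.
apply: (@rmorph_solution_ext _ (f \o inl) (f' \o inl)) => [a|].
  by rewrite /= !diff_aut_inl.
by move: ff'; rewrite -!map_mx_comp.
Qed.

(* The relations between the entries of [y] that [y *m g] has to satisfy for
   [y |-> y *m g] to define an endomorphism of [R (x) B]. *)
Definition translates (g g' : 'M[B]_n) : Prop := forall e,
  peval eta (mxval y y') e = 0 ->
  peval (inl \o eta) (mxval (map_mx inl y *m map_mx inr g)
                            (map_mx inr g' *m map_mx inl y')) e = 0.

Lemma translates_endo g g' : translates g g' ->
  exists f : {rmorphism T -> T}, [/\ forall a, f (inl (eta a)) = inl (eta a),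
    forall b, f (inr b) = inr b
    & map_mx f (map_mx inl y) = map_mx inl y *m map_mx inr g].
Proof.
move=> gg'; have [h [heta hy]] := rmorphism_extension (g := inl \o eta) y_gen gg'.
have [c|f [fl fr]] := @tensor_rmorphism_pure _ _ _ i j T h inr.
  by rewrite /= heta -tensor_in_scalar.
exists f; split=> [a|//|]; first by rewrite fl heta.
by apply/matrixP => a b; rewrite [LHS]mxE [in LHS]mxE fl; apply: (hy (false, a, b)).
Qed.

(** The endomorphisms of [g] and [g'] are mutually inverse because they are so on [y]. They commute
    with sigma because [A] acts on the left of [y], [g] on the right, and sigma fixes [g]. *)
Lemma translates_aut g g' : g *m g' = 1%:M -> g' *m g = 1%:M ->
  translates g g' -> translates g' g ->
  exists2 f : {rmorphism T -> T}, diff_aut f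
    & map_mx f (map_mx inl y) = map_mx inl y *m map_mx inr g.
Proof.
move=> gg' g'g /translates_endo[f [fl fr fy]] /translates_endo[f' [fl' fr' fy']].
have cancel_endo (u v : {rmorphism T -> T}) (h h' : 'M[B]_n) : h *m h' = 1%:M ->
    (forall a, u (inl (eta a)) = inl (eta a)) -> (forall b, u (inr b) = inr b) ->
    (forall a, v (inl (eta a)) = inl (eta a)) -> (forall b, v (inr b) = inr b) ->
    map_mx u (map_mx inl y) = map_mx inl y *m map_mx inr h ->
    map_mx v (map_mx inl y) = map_mx inl y *m map_mx inr h' -> cancel v u.
  move=> hh' ul ur vl vr uy vy t.
  apply: (@tensor_rmorphism_ext _ _ _ i j T (u \o v) idfun _ _ t) => [r|b]; last first.
    by rewrite /= vr ur.
  apply: (@rmorph_solution_ext _ (u \o v \o inl) inl) => [a|]; first by rewrite /= vl ul.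
  have -> : map_mx (u \o v \o inl) y = map_mx u (map_mx v (map_mx inl y)).
    by apply/matrixP => a b; rewrite !mxE.
  rewrite vy map_mxM uy.
  have -> : map_mx u (map_mx inr h') = map_mx inr h'.
    by apply/matrixP => a b; rewrite !mxE ur.
  by rewrite -mulmxA -map_mxM hh' map_mx1 mulmx1.
have [bs [bsE bsl bsr]] := base_sigma_rmorphism.
exists f => //; split.
- by exists f'; [apply: (cancel_endo f' f g' g)|apply: (cancel_endo f f' g g')].
- by move=> a b t; rewrite rmorphM -tensor_inlr rmorphM fl fr.
move=> t; rewrite -!bsE.
apply: (@tensor_rmorphism_ext _ _ _ i j T (f \o bs) (bs \o f) _ _ t) => [r|b]; last first.
  by rewrite /= bsr fr bsr.
apply: (@rmorph_solution_ext _ (f \o bs \o inl) (bs \o f \o inl)) => [a|].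
  by rewrite /= bsl -eta_sigma !fl bsl eta_sigma.
have bsy : map_mx bs (map_mx inl y) = map_mx inl (map_mx eta A) *m map_mx inl y.
  by rewrite -map_mxM -y_sigma; apply/matrixP => a b; rewrite !mxE bsl.
have -> : map_mx (f \o bs \o inl) y = map_mx f (map_mx bs (map_mx inl y)).
  by apply/matrixP => a b; rewrite !mxE.
have -> : map_mx (bs \o f \o inl) y = map_mx bs (map_mx f (map_mx inl y)).
  by apply/matrixP => a b; rewrite !mxE.
rewrite bsy map_mxM fy map_mxM bsy.
have -> : map_mx f (map_mx inl (map_mx eta A)) = map_mx inl (map_mx eta A).
  by apply/matrixP => a b; rewrite !mxE fl.
have -> : map_mx bs (map_mx inr g) = map_mx inr g.
  by apply/matrixP => a b; rewrite !mxE bsr.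
rewrite mulmxA; reflexivity.
Qed.

End Points.

Section BaseChange.
Variables (B B' : comNzRingType) (j : {rmorphism k -> B}) (j' : {rmorphism k -> B'}).
Variables (u : {rmorphism B -> B'}).
Hypothesis uj : forall c, u (j c) = j' c.
Variables (f : {rmorphism base_change eta j -> base_change eta j}).
Variables (f' : {rmorphism base_change eta j' -> base_change eta j'}).
Hypothesis f'f : forall t : base_change eta j,
  f' (tensor_map i j' idfun u t) = tensor_map i j' idfun u (f t).

(** Turns naturality of the group functor into specialization of matrices. *)
Lemma base_change_matrix (g : 'M[B]_n) :
  map_mx f (map_mx (tensor_inl i j) y)
    = map_mx (tensor_inl i j) y *m map_mx (tensor_inr i j) g ->
  map_mx f' (map_mx (tensor_inl i j') y)
    = map_mx (tensor_inl i j') y *m map_mx (tensor_inr i j') (map_mx u g).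
Proof.
move=> fy.
have [c|h hE] := @tensor_rmorphism _ _ _ i j (base_change eta j')
    (tensor_inl i j') (tensor_inr i j' \o u).
  by rewrite [LHS]tensor_in_scalar /= uj.
have hE' t : tensor_map i j' idfun u t = h t.
  rewrite hE /tensor_map; congr (tensor_lift _ t).
  by apply/funext => r; apply/funext => b; rewrite /= tensor_inlr.
have hl r : h (tensor_inl i j r) = tensor_inl i j' r.
  by rewrite -hE' [LHS](tensor_map_pure (f := idfun) (g := u)) // rmorph1.
have hr b : h (tensor_inr i j b) = tensor_inr i j' (u b).
  by rewrite -hE' [LHS](tensor_map_pure (f := idfun) (g := u)).
have hly (z : 'M[R]_n) : map_mx h (map_mx (tensor_inl i j) z) = map_mx (tensor_inl i j') z.
  by apply/matrixP => a b; rewrite !mxE hl.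
have hrg : map_mx h (map_mx (tensor_inr i j) g) = map_mx (tensor_inr i j') (map_mx u g).
  by apply/matrixP => a b; rewrite !mxE hr.
rewrite -hly -hrg -map_mxM -fy; apply/matrixP => a b.
have := f'f (tensor_inl i j (y a b)); rewrite !hE' => E.
by rewrite 3!mxE E [RHS]mxE [in RHS]mxE [in RHS]mxE.
Qed.

End BaseChange.
End Galois.

(** * The locus of a fundamental matrix *)

Lemma det_rpred (R : comPzRingType) (S : subringClosed R) n (M : 'M[R]_n) :
  (forall a b, M a b \in S) -> \det M \in S.
Proof.
move=> MS; apply: rpred_sum => s _; apply: rpredM; first by rewrite rpred_sign.
by apply: rpred_prod.
Qed.

Section Locus.
Variables (K U : diffField) (iota : {rmorphism K -> U}) (n : nat).
Local Notation V := (bool * 'I_n * 'I_n)%type.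

Definition kcu : {pred U} := fun x => `[< KCU iota x >].

Lemma kcu_divring : divring_closed kcu.
Proof.
split; first by apply/asboolP => S Sc _ _; case: Sc.
- move=> x y /asboolP xS /asboolP yS; apply/asboolP => S Sc KS CS.
  by have [_ + _] := Sc; apply; [apply: xS|apply: yS].
- move=> x y /asboolP xS /asboolP yS; apply/asboolP => S Sc KS CS.
  by have [_ _ +] := Sc; apply; [apply: xS|apply: yS].
Qed.

HB.instance Definition _ := GRing.isDivringClosed.Build U kcu kcu_divring.

Lemma kcu_iota a : iota a \in kcu.
Proof. by apply/asboolP => S _ KS _; apply: KS. Qed.

Lemma kcu_constant c : c \in constants U -> c \in kcu.
Proof. by move=> cC; apply/asboolP => S _ _; apply. Qed.

(** Inverse entries are cofactors over the determinant; a power of the determinant clears all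
    denominators. *)
Lemma pexp_mpoly (e : pexp K V) : exists P d, P \is a mpolyOver (n * n) kcu /\
  forall M : 'M[U]_n, M \in unitmx ->
  peval iota (mxval M (invmx M)) e * \det M ^+ d = mx_eval idfun M P.
Proof.

have DS : det_mpoly U n \is a mpolyOver (n * n) kcu.
  by apply: det_rpred => a b; rewrite mxE mpolyOverX.
elim: e => [c|[[[] a] b]|e1 [P1 [d1 [S1 E1]]] e2 [P2 [d2 [S2 E2]]]
           |e1 [P1 [d1 [S1 E1]]] e2 [P2 [d2 [S2 E2]]]].
- exists (iota c)%:MP, 0%N; split=> [|M _].
    by rewrite mpolyOverC kcu_iota.
  by rewrite mulr1 [RHS]mmapC.
- exists (\adj (\matrix_(a, b) ('X_(mxvec_index a b) : {mpoly U[n * n]})) a b), 1%N.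
  split=> [|M Mu].
    by rewrite mxE rpredMsign; apply: det_rpred => ? ?; rewrite !mxE mpolyOverX.
  rewrite expr1 /mxval /= /invmx Mu mxE mulrAC mulVf ?mul1r; last first.
    by rewrite -unitfE -unitmxE.
  have : M = map_mx (mx_eval idfun M) (\matrix_(a, b) 'X_(mxvec_index a b)).
    by apply/matrixP => a' b'; rewrite !mxE [RHS]mmapX mmap1U mxvecE.
  by move=> {1}->; rewrite -map_mx_adj mxE.
- exists 'X_(mxvec_index a b), 0%N; split=> [|M _]; first by rewrite mpolyOverX.
  by rewrite mulr1 [RHS]mmapX mmap1U mxvecE.
- exists (P1 * det_mpoly U n ^+ d2 + P2 * det_mpoly U n ^+ d1), (d1 + d2)%N.
  split=> [|M Mu]; first by rewrite rpredD // rpredM // rpredX.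
  rewrite /mx_eval rmorphD !rmorphM !rmorphXn /= -!/(mx_eval _ _ _) det_mpolyE.
  by rewrite -E1 // -E2 // exprD mulrDl mulrA [_ * _ ^+ d1 * _ in RHS]mulrAC
    -!mulrA [_ ^+ d2 * _]mulrC.
- exists (P1 * P2), (d1 + d2)%N; split=> [|M Mu]; first by rewrite rpredM.
  by rewrite /mx_eval rmorphM /= -!/(mx_eval _ _ _) -E1 // -E2 // exprD mulrACA.
Qed.

(** The lists present elements of K[Y, 1/det Y] tensored with the constants of [U]; [M'] is the slot
    for the inverse of [M]. *)
Definition plist_eval (M M' : 'M[U]_n) (l : seq (pexp K V * constField U)) : U :=
  \sum_(p <- l) peval iota (mxval M M') p.1 * val p.2.

Lemma plist_mpoly l : exists P d, P \is a mpolyOver (n * n) kcu /\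
  forall M : 'M[U]_n, M \in unitmx ->
  plist_eval M (invmx M) l * \det M ^+ d = mx_eval idfun M P.
Proof.
have DS : det_mpoly U n \is a mpolyOver (n * n) kcu.
  by apply: det_rpred => a b; rewrite mxE mpolyOverX.
elim: l => [|[e c] l [P [d [PS PE]]]].
  exists 0, 0%N; split=> [|M _]; first exact: rpred0.
  by rewrite /plist_eval big_nil mul0r [RHS]rmorph0.
have [Q [d' [QS QE]]] := pexp_mpoly e.
exists (Q * (val c)%:MP * det_mpoly U n ^+ d + P * det_mpoly U n ^+ d'), (d' + d)%N.
split=> [|M Mu].
  rewrite rpredD // rpredM // ?rpredX // rpredM // mpolyOverC.
  exact/kcu_constant/valP.
rewrite /mx_eval rmorphD !rmorphM !rmorphXn /= -!/(mx_eval _ _ _) det_mpolyE.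
rewrite -PE // -QE // [mx_eval _ _ (val c)%:MP]mmapC /plist_eval big_cons mulrDl exprD.
by congr (_ + _); [rewrite mulrA [_ * val c * _]mulrAC | rewrite mulrA mulrAC].
Qed.

(** The ring generated by [K] and the constants, whose fraction field is the compositum [kcu]. *)
Definition kc_num : {pred U} := fun x =>
  `[< exists l : seq (K * constField U), x = \sum_(p <- l) iota p.1 * val p.2 >].

Lemma kc_num_subring : subring_closed kc_num.
Proof.
split.
- apply/asboolP; exists [:: (1, 1)].
  by rewrite big_seq1 !rmorph1 mulr1.
- move=> _ _ /asboolP[l ->] /asboolP[l' ->]; apply/asboolP.
  exists (l ++ [seq (- p.1, p.2) | p <- l']).
  rewrite big_cat big_map -sumrN; congr (_ + _); apply: eq_bigr => p _.
  by rewrite rmorphN mulNr.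
- move=> _ _ /asboolP[l ->] /asboolP[l' ->]; apply/asboolP.
  exists [seq (p.1 * q.1, p.2 * q.2) | p <- l, q <- l'].
  rewrite big_allpairs_dep /= mulr_suml; apply: eq_bigr => p _; rewrite mulr_sumr.
  by apply: eq_bigr => q _; rewrite !rmorphM mulrACA.
Qed.

HB.instance Definition _ := GRing.isSubringClosed.Build U kc_num kc_num_subring.

Lemma kcu_fraction x : x \in kcu ->
  exists a b, [/\ a \in kc_num, b \in kc_num, b != 0 & x = a / b].
Proof.
move=> /asboolP xK; pose S : {pred U} := fun x => `[< exists a b,
  [/\ a \in kc_num, b \in kc_num, b != 0 & x = a / b] >].
have numS a : a \in kc_num -> a \in S.
  by move=> aN; apply/asboolP; exists a, 1; rewrite rpred1 oner_neq0 divr1.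
apply/(@asboolP (exists a b, [/\ a \in kc_num, b \in kc_num, b != 0 & x = a / b])).
apply: (xK S) => [|a|c cC].
- split; first by apply: numS; apply: rpred1.
    move=> _ _ /asboolP[a [b [aN bN b0 ->]]] /asboolP[a' [b' [aN' bN' b0' ->]]].
    apply/asboolP; exists (a * b' - a' * b), (b * b').
    rewrite rpredB ?rpredM // mulf_neq0 //; split=> //.
    by rewrite -mulNr addf_div // mulNr.
  move=> _ _ /asboolP[a [b [aN bN b0 ->]]] /asboolP[a' [b' [aN' bN' b0' ->]]].
  apply/asboolP; have [->|a0'] := eqVneq a' 0.
    by exists 0, 1; rewrite rpred0 rpred1 oner_neq0 mul0r invr0 mulr0 mul0r.
  exists (a * b'), (b * a'); rewrite !rpredM // mulf_neq0 //; split=> //.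
  by rewrite invf_div mulf_div.
- apply: numS; apply/asboolP; exists [:: (a, 1)].
  by rewrite big_seq1 rmorph1 mulr1.
- apply: numS; apply/asboolP; exists [:: (1, exist _ c cC)].
  by rewrite big_seq1 rmorph1 mul1r.
Qed.

Lemma kcu_common_denominator (s : seq U) : (forall x, x \in s -> x \in kcu) ->
  exists2 d, d != 0 & d \in kc_num /\ forall x, x \in s -> d * x \in kc_num.
Proof.
elim: s => [|x s IH] sK.
  by exists 1; [exact: oner_neq0|split=> //; apply: rpred1].
have [|d d0 [dN ds]] := IH; first by move=> z zs; apply: sK; rewrite inE zs orbT.
have [a [b [aN bN b0 xE]]] := kcu_fraction (sK x (mem_head _ _)).
exists (d * b); first exact: mulf_neq0.
split=> [|z]; first exact: rpredM.
rewrite inE => /predU1P[->|/ds dz].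
  by rewrite xE -mulrA [b * _]mulrC divfK // rpredM.
by rewrite mulrAC rpredM.
Qed.

(** Quantifying over all [M'] expresses that the inverse entries do not affect the value. *)
Definition kc_fun (f : 'M[U]_n -> U) : Prop :=
  exists l, forall M M', f M = plist_eval M M' l.

Lemma kc_fun_mul f g : kc_fun f -> kc_fun g -> kc_fun (fun M => f M * g M).
Proof.
move=> [l lE] [l' l'E].
exists [seq (PMul p.1 q.1, p.2 * q.2) | p <- l, q <- l'] => M M'.
rewrite /plist_eval big_allpairs_dep /= (lE M M') (l'E M M') mulr_suml.
apply: eq_bigr => p _; rewrite mulr_sumr.
by apply: eq_bigr => q _; rewrite mulrACA -(rmorphM (val : {rmorphism constField U -> U})).
Qed.

Lemma kc_fun_num x : x \in kc_num -> kc_fun (fun=> x).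
Proof.
move=> /asboolP[l ->]; exists [seq (PConst V p.1, p.2) | p <- l] => M M'.
by rewrite /plist_eval big_map.
Qed.

Lemma kc_fun_exp f e : kc_fun f -> kc_fun (fun M => f M ^+ e).
Proof.
move=> fK; elim: e => [|e IH]; first by apply: kc_fun_num; rewrite rpred1.
have [l lE] := kc_fun_mul fK IH; exists l => M M'.
by rewrite exprS (lE M M').
Qed.

Lemma kc_fun_mmap1 m : kc_fun (fun M => mmap1 (fun v => mxvec M 0 v) m).
Proof.
have entry v : kc_fun (fun M => mxvec M 0 v).
  case/mxvec_indexP: v => a b; exists [:: (PVar K (false, a, b), 1)] => M M'.
  by rewrite /plist_eval big_seq1 rmorph1 mulr1 mxvecE.
rewrite /mmap1; elim: (index_enum _) => [|v s IH].
  have [l lE] := kc_fun_num (rpred1 _); exists l => M M'.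
  by rewrite big_nil (lE M M').
have [l lE] := kc_fun_mul (kc_fun_exp (m v) (entry v)) IH; exists l => M M'.
by rewrite big_cons (lE M M').
Qed.

Lemma kc_fun_mpoly (P : {mpoly U[n * n]}) : P \is a mpolyOver (n * n) kcu ->
  exists2 d, d != 0 & kc_fun (fun M => d * mx_eval idfun M P).
Proof.
move=> /mpolyOverP PS.
have [|d d0 [_ dP]] := @kcu_common_denominator [seq P@_m | m <- msupp P].
  by move=> _ /mapP[m _ ->].
exists d => //; rewrite /mx_eval /mmap.
have {dP}: forall m, m \in msupp P -> d * P@_m \in kc_num.
  by move=> m mP; apply/dP/map_f.
elim: (msupp P) => [|m s IH] dP.
  have [l lE] := kc_fun_num (rpred0 _); exists l => M M'.
  by rewrite big_nil mulr0 (lE M M').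
have [|l lE] := IH; first by move=> m' m's; apply: dP; rewrite inE m's orbT.
have [l' l'E] := kc_fun_mul (kc_fun_num (dP m (mem_head _ _))) (kc_fun_mmap1 m).
exists (l' ++ l) => M M'.
by rewrite /plist_eval big_cons mulrDr mulrA (l'E M M') (lE M M') big_cat.
Qed.

Variable T : 'M[U]_n.
Hypothesis T_unit : T \in unitmx.

(** Equations over the compositum and relations presented by lists have the same zeros in GL_n: one
    passage clears powers of the determinant, the other a common denominator of the coefficients. *)
Lemma locusP M : locus (KCU iota) T M <-> M \in unitmx /\
  forall l, plist_eval T (invmx T) l = 0 -> plist_eval M (invmx M) l = 0.
Proof.
split=> [MT|[Mu ME] X [S SK ->] [_ TS]].
  have Mu : M \in unitmx.
    (* The empty system cuts out GL_n itself, which contains [T]. *)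
    suff [] : gl_zeros (fun=> False) M by [].
    apply: MT; last by split.
    by exists (fun=> False).
  split=> // l; have [P [d [PS PE]]] := plist_mpoly l => lT.
  suff [_ /(_ P erefl)] : gl_zeros (fun Q => Q = P) M.
    rewrite -PE // => /eqP; rewrite mulf_eq0 expf_eq0 => /orP[/eqP //|/andP[_]].
    by move: Mu; rewrite unitmxE unitfE => /negP.
  apply: MT; first by exists (fun Q => Q = P) => // Q m ->; have /mpolyOverP/(_ m)/asboolP := PS.
  by split=> // _ ->; rewrite -PE // lT mul0r.
split=> // P SP.
have [|d d0 [l lE]] := @kc_fun_mpoly P.
  by apply/mpolyOverP => m; apply/asboolP/SK.
apply: (mulfI d0); rewrite mulr0 (lE M (invmx M)); apply: ME.
by rewrite -(lE T) TS // mulr0.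
Qed.

End Locus.

(** * Comparison of the two solutions *)

Section Comparison.
Variables (U : diffField) (K : diffField) (iota : {rmorphism K -> U}).
Hypothesis iota_diff : diff_morph iota.
Variables (n : nat) (A : 'M[K]_n) (R : diffRing) (eta : {rmorphism K -> R}).
Variables (y y' : 'M[R]_n).
Hypothesis eta_sigma : forall a, eta (dsigma a) = rsigma (eta a).
Hypotheses (yy' : y *m y' = 1%:M) (y'y : y' *m y = 1%:M).
Hypothesis y_sigma : map_mx rsigma y = map_mx eta A *m y.
Hypothesis y_gen : forall r : R, exists e, r = peval eta (mxval y y') e.
Variable T : 'M[U]_n.
Hypotheses (T_unit : T \in unitmx) (T_sigma : map_mx dsigma T = map_mx iota A *m T).
Local Notation V := (bool * 'I_n * 'I_n)%type.
Local Notation T' := (invmx T).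
Local Notation C := (constField U).
Local Notation cval := (val : {rmorphism C -> U}).

Lemma field_sigma_simple : sigma_simple (@dsigma U).
Proof.
move=> I _ IM _ x Ix /eqP x0; rewrite -(mulVf x0); exact: IM.
Qed.

Lemma constant_val_fixed (c : C) : dsigma (cval c) = cval c.
Proof. exact/eqP/(valP c). Qed.

Lemma constant_val_onto r : dsigma r = r -> exists c, r = cval c.
Proof. by move=> /eqP rC; exists (exist _ r rC). Qed.

Lemma iter_sigma_solution N : exists Q : 'M[K]_n,
  map_mx (rmorph_iter rsigma N) y = map_mx eta Q *m y /\
  map_mx (rmorph_iter dsigma N) T = map_mx iota Q *m T.
Proof.
elim: N => [|N [Q [yQ TQ]]].
  by exists 1%:M; rewrite !map_mx1 !mul1mx; split; apply/matrixP => a b; rewrite mxE.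
exists (map_mx dsigma Q *m A); rewrite !map_mxM -!mulmxA -y_sigma -T_sigma.
have -> : map_mx eta (map_mx dsigma Q) = map_mx rsigma (map_mx eta Q).
  by apply/matrixP => a b; rewrite !mxE eta_sigma.
have -> : map_mx iota (map_mx dsigma Q) = map_mx dsigma (map_mx iota Q).
  by apply/matrixP => a b; rewrite !mxE iota_diff.
by rewrite -!map_mxM -yQ -TQ; split; apply/matrixP => a b; rewrite !mxE.
Qed.

Lemma iter_sigma_eta N a : rmorph_iter rsigma N (eta a) = eta (rmorph_iter dsigma N a).
Proof. by elim: N => //= N ->; rewrite eta_sigma. Qed.

Lemma iter_sigma_iota N a : rmorph_iter dsigma N (iota a) = iota (rmorph_iter dsigma N a).
Proof. by elim: N => //= N ->; rewrite iota_diff. Qed.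

Lemma mulmx_inverse_uniq (S : comPzRingType) (M N N' : 'M[S]_n) :
  N' *m M = 1%:M -> M *m N = 1%:M -> N' = N.
Proof. by move=> NM MN; rewrite -[N']mulmx1 -MN mulmxA NM mul1mx. Qed.

Section TwoSolutions.
Variables (E : comPzRingType) (g : {rmorphism U -> E}) (h : {rmorphism R -> E}).
Hypothesis hg : forall a, h (eta a) = g (iota a).
Variables (N N' : 'M[E]_n).
Hypothesis NN' : N *m N' = 1%:M.
Hypothesis hy : map_mx h y = map_mx g T *m N.

(** Neither [g] nor [h] is assumed to commute with sigma: iterating inside multiplies both sides on
    the left by the same matrix over [K], and [N] stays fixed. *)
Lemma iter_solution s :
  map_mx (h \o rmorph_iter rsigma s) y = map_mx (g \o rmorph_iter dsigma s) T *m N /\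
  map_mx (h \o rmorph_iter rsigma s) y' = N' *m map_mx (g \o rmorph_iter dsigma s) T'.
Proof.
have yT : map_mx (h \o rmorph_iter rsigma s) y
    = map_mx (g \o rmorph_iter dsigma s) T *m N.
  have [Q [yQ TQ]] := iter_sigma_solution s.
  rewrite (map_mx_comp (rmorph_iter rsigma s) h) yQ.
  rewrite (map_mx_comp (rmorph_iter dsigma s) g) TQ (map_mxM h) (map_mxM g) hy mulmxA; congr (_ *m _ *m _).
  by apply/matrixP => a b; rewrite !mxE hg.
split=> //; apply: mulmx_inverse_uniq (map_mx (h \o rmorph_iter rsigma s) y) _ _ _ _.
  by rewrite -map_mxM y'y map_mx1.
rewrite yT mulmxA -[_ *m N *m N']mulmxA NN' mulmx1 -map_mxM mulmxV //.
by rewrite map_mx1.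
Qed.

(** Applying [h] after every iterate of sigma to the relation [e] of [y] kills the split sum with
    its [T]-part iterated, which is the input of [simple_descent] over the field [U] and its
    constants. *)
Lemma descent_constants e (l : seq (pexp K V * pexp unit V)) (d : E -> C) :
  peval eta (mxval y y') e = 0 ->
  (forall (S : comPzRingType) (f : K -> S) (M M' P P' : 'M[S]_n),
    peval f (mxval (M *m P) (P' *m M')) e
    = \sum_(p <- l) peval f (mxval M M') p.1 * peval (fun=> 1) (mxval P P') p.2) ->
  linear_form (g \o cval) d ->
  \sum_(p <- l) peval iota (mxval T T') p.1
    * cval (d (peval (fun=> 1) (mxval N N') p.2)) = 0.
Proof.
move=> e0 lE dl.
pose l' := [seq (peval iota (mxval T T') p.1, peval (fun=> 1) (mxval N N') p.2) | p <- l].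
have := @simple_descent C U cval dsigma field_sigma_simple constant_val_fixed
  constant_val_onto E g l' _ d dl.
rewrite big_map; apply=> s; rewrite big_map.
have [hs hs'] := iter_solution s.
have := congr1 (h \o rmorph_iter rsigma s) e0.
rewrite [RHS]rmorph0 [LHS]rmorph_peval_mx hs hs' lE => E0; rewrite -[RHS]E0.
apply: eq_bigr => p _; congr (_ * _).
rewrite -rmorph_iterE -[LHS]/((g \o rmorph_iter dsigma s) _) rmorph_peval_mx.
by apply: eq_peval => // a; rewrite /= iter_sigma_iota iter_sigma_eta hg.
Qed.

End TwoSolutions.

(** The set V of the overview. The morphism [h] need not respect sigma, so [M] need not solve the
    difference system. *)
Definition solution_point (M : 'M[U]_n) : Prop :=
  exists h : {rmorphism R -> U}, (forall a, h (eta a) = iota a) /\ map_mx h y = M.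

Lemma solution_pointI (M M' : 'M[U]_n) :
  (forall e, peval eta (mxval y y') e = 0 -> peval iota (mxval M M') e = 0) ->
  solution_point M.
Proof.
move=> /(rmorphism_extension y_gen)[h [heta hy]]; exists h; split=> //.
by apply/matrixP => a b; rewrite mxE; apply: (hy (false, a, b)).
Qed.

Lemma solution_point_unit M : solution_point M -> M \in unitmx.
Proof.
move=> [h [_ <-]]; have : map_mx h y *m map_mx h y' = 1%:M by rewrite -map_mxM yy' map_mx1.
by case/mulmx1_unit.
Qed.

(* Two solutions [y] and [T] in [R (x)_K U] differ by a constant matrix [Z], and
   by descent the relations between the entries of [T *m Z = y] are generated by
   relations with constant coefficients between the entries of [Z]; these have a
   solution in [U]. *)
Lemma solution_point_exists : generic U -> ~ countable [set: C] ->
  exists2 c, c \in unitmx & solution_point (T *m c).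
Proof.
move=> Ug Cu.
pose inR := tensor_inl eta iota; pose inU := tensor_inr eta iota.
pose E := tensor eta iota.
pose Z := map_mx inU T' *m map_mx inR y; pose Z' := map_mx inR y' *m map_mx inU T.
have ZZ' : Z *m Z' = 1%:M.
  rewrite /Z mulmxA -[_ *m map_mx inR y']mulmxA -map_mxM yy' map_mx1 mulmx1.
  by rewrite -map_mxM mulVmx // map_mx1.
have [c cP] := constant_point Ug Cu (inU : {rmorphism U -> E}) (mxval Z Z')
  (tensor_oner_neq0 eta iota).
pose cm := \matrix_(a, b) c (false, a, b); pose cm' := \matrix_(a, b) c (true, a, b).
have cE : mxval cm cm' =1 c by move=> [[[] a] b]; rewrite /mxval /= mxE.
(* The entries of the identity [ZZ'] are relations with constant coefficients, so they pass from [Z]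
   to [c]. *)
have cc' : cm *m cm' = 1%:M.
  apply/matrixP => a b.
  have [e eE] := @peval_sum C V _ (enum 'I_n)
    (fun m => PMul (PVar C (false, a, m)) (PVar C (true, m, b))) 0.
  have sumE (S : pzRingType) (f : {rmorphism C -> S}) x :
      peval f x (PAdd e (PConst V (- (a == b)%:R)))
      = \sum_m x (false, a, m) * x (true, m, b) - (a == b)%:R.
    by rewrite /= eE ?rmorph0 // big_enum /= rmorphN rmorph_nat.
  have /cP : peval (inU \o val) (mxval Z Z') (PAdd e (PConst V (- (a == b)%:R))) = 0.
    rewrite (sumE _ (inU \o val)).
    have := congr1 (fun M : 'M_n => M a b) ZZ'; rewrite mxE [1%:M a b]mxE => <-.
    by rewrite subrr.
  rewrite (sumE _ val) => /eqP; rewrite subr_eq0 => /eqP cE'.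
  by rewrite mxE [RHS]mxE -cE'; apply: eq_bigr => m _; rewrite !mxE.
exists cm; first by case/mulmx1_unit: cc'.
apply: (@solution_pointI _ (cm' *m T')) => e e0.
have [l lE] := peval_mulmx e.
have hg a : inR (eta a) = inU (iota a) by exact: tensor_in_scalar.
have yT : map_mx inR y = map_mx inU T *m Z.
  by rewrite /Z mulmxA -map_mxM mulmxV // map_mx1 mul1mx.
have D := @descent_constants E inU inR hg Z Z' ZZ' yT e l _ e0 lE.
rewrite lE.
pose l' := [seq (peval iota (mxval T T') p.1, peval (fun=> 1) (mxval cm cm') p.2) | p <- l].
suff : \sum_(p <- l') idfun p.1 * idfun p.2 = 0 by rewrite big_map.
apply: (@pairing_eval_left C U U U val val) => // m ml.
(* Contracting the [T]-part with the form [m] leaves a relation on [Z] whose coefficients are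
   constants, the kind that [cP] transfers. *)
have [em emE] := @peval_sum C V _ l (fun p => PMul (PConst V (m (peval iota (mxval T T') p.1)))
  (pexp_map (fun=> 1) p.2)) 0.
have sumE (S : comPzRingType) (f : {rmorphism C -> S}) x : peval f x em =
    \sum_(p <- l) f (m (peval iota (mxval T T') p.1)) * peval (fun=> 1) x p.2.
  rewrite emE ?rmorph0 //; apply: eq_bigr => p _ /=; congr (_ * _).
  by rewrite peval_map; apply: eq_peval => // -[] /=; rewrite rmorph1.
rewrite big_map /=.
have /cP : peval (inU \o val) (mxval Z Z') em = 0.
  pose lz := [seq (peval iota (mxval T T') p.1, peval (fun=> 1) (mxval Z Z') p.2) | p <- l].
  rewrite (sumE _ (inU \o val)).
  have := @pairing_swap C U E val (inU \o val) lz _ m ml.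
  rewrite big_map; apply=> d dl; rewrite big_map; exact: D.
rewrite (sumE _ val) => E0; rewrite -[RHS]E0; apply: eq_bigr => p _; congr (_ * _).
by apply: eq_peval => // v; rewrite cE.
Qed.

Hypotheses (R_simple : sigma_simple (@rsigma R)) (newC : no_new_constants eta).

(** * The locus of T and the solution points *)

Section Locus.
Variables (c : 'M[U]_n) (c_unit : c \in unitmx) (Tc : solution_point (T *m c)).
Local Notation c' := (invmx c).

(** Split a relation of [y] at T c and contract the [c]-part by forms over the constants: this gives
    relations of [T] over [K] and the constants. They hold at [M] as well, and reassemble to the
    relation at M c. *)
Lemma locus_solution M : locus (KCU iota) T M -> solution_point (M *m c).
Proof.
move=> /(locusP _ T_unit)[Mu ME]; have [h [heta hy]] := Tc.
apply: (@solution_pointI _ (c' *m invmx M)) => e e0; have [l lE] := peval_mulmx e.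
rewrite lE.
pose l' := [seq (peval iota (mxval M (invmx M)) p.1, peval (fun=> 1) (mxval c c') p.2) | p <- l].
suff : \sum_(p <- l') idfun p.1 * idfun p.2 = 0 by rewrite big_map.
apply: (@pairing_eval C U U val val) => // d dl; rewrite big_map /=.
have := ME [seq (p.1, d (peval (fun=> 1) (mxval c c') p.2)) | p <- l].
rewrite /plist_eval !big_map /=; apply.
apply: (@descent_constants U idfun h heta c c' (mulmxV c_unit) _ e l d) => //.
by rewrite hy; congr (_ *m _); apply/matrixP => a b; rewrite mxE.
Qed.

(** A relation of [T], rewritten through T = (T c) c^-1, becomes an element of [R] tensored with
    [U]. It is killed by [h] after every iterate of sigma, so it is zero by simplicity of [R], and
    evaluating it at [M] gives the claim. *)
Lemma solution_locus M : solution_point M -> locus (KCU iota) T (M *m c').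
Proof.
move=> Msol; have Mu := solution_point_unit Msol.
have [h [heta hy]] := Tc; have [h1 [h1eta h1y]] := Msol.
apply/(locusP _ T_unit); split=> [|l lT]; first by rewrite unitmx_mul Mu unitmx_inv.
have h1y' : map_mx h1 y' = invmx M.
  apply: (@mulmx_inverse_uniq _ M); last exact: mulmxV.
  by rewrite -h1y -map_mxM y'y map_mx1.
have -> : invmx (M *m c') = c *m invmx M.
  apply: (@mulmx_inverse_uniq _ (M *m c')).
    by rewrite mulVmx // unitmx_mul Mu unitmx_inv.
  by rewrite mulmxA -[_ *m c' *m c]mulmxA mulVmx // mulmx1 mulmxV.
have [x xE] := choice (fun e : pexp K V => peval_mulmx e).
pose L := [seq (q.1, peval (fun=> 1) (mxval c' c) q.2 * cval p.2) | p <- l, q <- x p.1].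
have LE (S : comPzRingType) (f : K -> S) (g : {rmorphism U -> S}) (N N' : 'M[S]_n) :
    \sum_(r <- L) peval f (mxval N N') r.1 * g r.2
    = \sum_(p <- l) peval f (mxval (N *m map_mx g c') (map_mx g c *m N')) p.1 * g (cval p.2).
  rewrite big_allpairs_dep; apply: eq_bigr => p _.
  rewrite xE mulr_suml; apply: eq_bigr => q _.
  rewrite rmorphM rmorph_peval_mx mulrA; congr (_ * _ * _).
  by apply: eq_peval => // u; rewrite /= rmorph1.
have id_mx (N : 'M[U]_n) : map_mx idfun N = N by apply/matrixP => a b; rewrite mxE.
have -> : plist_eval iota (M *m c') (c *m invmx M) l
    = \sum_(r <- L) peval iota (mxval M (invmx M)) r.1 * r.2.
  by rewrite (LE U iota idfun) !id_mx.
pose L' := [seq (peval eta (mxval y y') r.1, r.2) | r <- L].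
have : \sum_(r <- L') h1 r.1 * idfun r.2 = 0; last first.
  rewrite big_map => E0; rewrite -[RHS]E0; apply: eq_bigr => r _; congr (_ * _).
  by rewrite rmorph_peval_mx h1y h1y'; apply: eq_peval => // a; rewrite /= h1eta.
apply: (@pairing_eval (constField K) R U (const_incl eta) (h \o const_incl eta)).
  by move=> a; rewrite /= heta h1eta.
move=> d dl; apply: (@simple_descent _ R (const_incl eta) rsigma R_simple
  (const_incl_fixed eta_sigma) (const_incl_onto newC) U h L' _ d dl) => s.
rewrite big_map.
have [hs hs'] := @iter_solution U idfun h heta c c' (mulmxV c_unit)
  (etrans hy (esym (congr1 (mulmx^~ c) (id_mx T)))) s.
have -> : \sum_(r <- L) h (iter s rsigma (peval eta (mxval y y') r.1)) * r.2
    = \sum_(r <- L) peval (h \o rmorph_iter rsigma s \o eta)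
        (mxval (map_mx (idfun \o rmorph_iter dsigma s) T *m c)
               (c' *m map_mx (idfun \o rmorph_iter dsigma s) T')) r.1 * idfun r.2.
  apply: eq_bigr => r _; congr (_ * _).
  rewrite -rmorph_iterE -[LHS]/((h \o rmorph_iter rsigma s) _) rmorph_peval_mx.
  by rewrite hs hs'.
rewrite (LE U _ idfun) !id_mx -[_ *m c *m c']mulmxA mulmxV // mulmx1.
rewrite mulmxA mulmxV // mul1mx.
(* Applying sigma to the relation of [T] iterates [T] and the coefficients from [K] but fixes the
   constants, which matches the iterated left side. *)
have := congr1 (rmorph_iter dsigma s) lT; rewrite rmorph0 => E0; rewrite -[RHS]E0.
rewrite rmorph_sum; apply: eq_bigr => p _; rewrite rmorphM; congr (_ * _); last first.
  rewrite rmorph_iterE -[LHS]/(cval p.2); elim: s {hs hs' E0} => //= s <-.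
  by rewrite constant_val_fixed.
rewrite rmorph_peval_mx; apply: eq_peval => [a|v]; last first.
  by congr (mxval _ _ v); apply/matrixP => i j; rewrite !mxE.
by rewrite /= iter_sigma_eta heta iter_sigma_iota.
Qed.

End Locus.

(** The two points differ by [P] after every iterate of sigma as well, so [e] at the second is an
    evaluation at the first of the split sum. Simplicity of [R] then makes that sum zero as a
    tensor. *)
Lemma translate_descent (h h' : {rmorphism R -> U}) (P P' : 'M[U]_n) e
    (l : seq (pexp K V * pexp unit V)) d :
  (forall a, h (eta a) = iota a) -> (forall a, h' (eta a) = iota a) ->
  P *m P' = 1%:M -> map_mx h' y = map_mx h y *m P ->
  peval eta (mxval y y') e = 0 ->
  (forall (S : comPzRingType) (f : K -> S) (M M' N N' : 'M[S]_n),
    peval f (mxval (M *m N) (N' *m M')) e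
    = \sum_(p <- l) peval f (mxval M M') p.1 * peval (fun=> 1) (mxval N N') p.2) ->
  linear_form (h \o const_incl eta) d ->
  \sum_(p <- l) peval eta (mxval y y') p.1
    * const_incl eta (d (peval (fun=> 1) (mxval P P') p.2)) = 0.
Proof.
move=> heta h'eta PP' h'y e0 lE dl.
have id_T : map_mx idfun T = T by apply/matrixP => a b; rewrite mxE.
(* Any point is [T] times an invertible matrix, the form that [iter_solution] needs. *)
have [c [c' [cc' hy]]] : exists c c', c *m c' = 1%:M /\ map_mx h y = map_mx idfun T *m c.
  exists (T' *m map_mx h y), (map_mx h y' *m T); split; last by rewrite id_T mulKVmx.
  rewrite mulmxA -[_ *m map_mx h y']mulmxA -map_mxM yy' map_mx1 mulmx1.
  exact: mulVmx.
have h'y2 : map_mx h' y = map_mx idfun T *m (c *m P) by rewrite mulmxA -hy h'y.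
have cP : (c *m P) *m (P' *m c') = 1%:M.
  by rewrite mulmxA -[_ *m P *m P']mulmxA PP' mulmx1.
pose l' := [seq (peval eta (mxval y y') p.1, peval (fun=> 1) (mxval P P') p.2) | p <- l].
have := @simple_descent _ R (const_incl eta) rsigma R_simple
  (const_incl_fixed eta_sigma) (const_incl_onto newC) U h l' _ d dl.
rewrite big_map; apply=> s; rewrite big_map.
have [hs hs'] := @iter_solution U idfun h heta c c' cc' hy s.
have [h's h's'] := @iter_solution U idfun h' h'eta _ _ cP h'y2 s.
have := congr1 (h' \o rmorph_iter rsigma s) e0.
rewrite [RHS]rmorph0 [LHS]rmorph_peval_mx h's h's' !mulmxA.
rewrite -[X in peval _ (mxval _ X)]mulmxA -hs -hs' lE => E0; rewrite -[RHS]E0.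
apply: eq_bigr => p _; congr (_ * _).
rewrite -rmorph_iterE -[LHS]/((h \o rmorph_iter rsigma s) _) rmorph_peval_mx.
by apply: eq_peval => // a; rewrite /= iter_sigma_eta heta h'eta.
Qed.

End Comparison.

(** * The isomorphism *)

Lemma mx_inverse_from_det (B : comNzRingType) m (g : 'M[B]_m) d : \det g * d = 1 ->
  exists2 g', g *m g' = 1%:M & g' *m g = 1%:M.
Proof.
move=> gd; exists (d *: \adj g).
  by rewrite -scalemxAr mul_mx_adj scale_scalar_mx mulrC gd.
by rewrite -scalemxAl mul_adj_mx scale_scalar_mx mulrC gd.
Qed.

Lemma gl_points_map (k B B' : comNzRingType) (j : {rmorphism k -> B})
    (j' : {rmorphism k -> B'}) (u : {rmorphism B -> B'}) m S (g : 'M[B]_m) :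
  (forall c, u (j c) = j' c) -> gl_points S j g -> gl_points S j' (map_mx u g).
Proof.
move=> uj [[d gd] gS]; split=> [|p Sp].
  by exists (u d); rewrite det_map_mx -rmorphM gd rmorph1.
by rewrite -(rmorph_mx_eval g p uj) gS // rmorph0.
Qed.

Section Stabilizer.
Variables (U : diffField) (n : nat) (W : set 'M[U]_n).

Lemma right_stabilizer1 : right_stabilizer W 1%:M.
Proof.
split; first exact: unitmx1.
by apply/seteqP; split=> M; [move=> [N WN <-]|exists M => //]; rewrite mulmx1.
Qed.

Lemma right_stabilizer_mul h M : right_stabilizer W h -> W M -> W (M *m h).
Proof. by move=> [_ Wh] WM; rewrite -Wh; exists M. Qed.

Lemma right_stabilizer_inv h : right_stabilizer W h -> right_stabilizer W (invmx h).
Proof.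
move=> [hu Wh]; split; first by rewrite unitmx_inv.
apply/seteqP; split=> [M [N] | M WM].
  by rewrite -{1}Wh => -[N' WN' <-] <-; rewrite mulmxK.
by exists (M *m h); [apply: right_stabilizer_mul | rewrite mulmxK].
Qed.

Lemma right_stabilizerI h : h \in unitmx -> (forall M, W M -> W (M *m h)) ->
  (forall M, W M -> W (M *m invmx h)) -> right_stabilizer W h.
Proof.
move=> hu Wh Wh'; split=> //; apply/seteqP; split=> [_ [M WM <-]|M WM]; first exact: Wh.
by exists (M *m invmx h); [apply: Wh' | rewrite mulmxKV].
Qed.

End Stabilizer.

Section Isomorphism.
Variables (U : diffField) (K : diffField) (iota : {rmorphism K -> U}).
Hypothesis iota_diff : diff_morph iota.
Variables (n : nat) (A : 'M[K]_n) (R : diffRing) (eta : {rmorphism K -> R}).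
Variables (y y' : 'M[R]_n).
Hypothesis eta_sigma : forall a, eta (dsigma a) = rsigma (eta a).
Hypotheses (yy' : y *m y' = 1%:M) (y'y : y' *m y = 1%:M).
Hypothesis y_sigma : map_mx rsigma y = map_mx eta A *m y.
Hypothesis y_gen : forall r : R, exists e, r = peval eta (mxval y y') e.
Hypotheses (R_simple : sigma_simple (@rsigma R)) (newC : no_new_constants eta).
Variable T : 'M[U]_n.
Hypotheses (T_unit : T \in unitmx) (T_sigma : map_mx dsigma T = map_mx iota A *m T).
Variables (c : 'M[U]_n) (c_unit : c \in unitmx).
Hypothesis Tc : solution_point iota eta y (T *m c).
Local Notation c' := (invmx c).
Local Notation k := (constField K).
Local Notation i := (const_incl eta).
Local Notation j := (const_incl iota).
Local Notation W := (locus (KCU iota) T).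
Local Notation H := (right_stabilizer W).
Local Notation sol := (solution_point iota eta y).
Local Notation inl j := (tensor_inl i j).
Local Notation inr j := (tensor_inr i j).

Lemma locus_solution_iff M : W M <-> sol (M *m c).
Proof.
split=> [|Ms].
  exact: (locus_solution iota_diff eta_sigma y'y y_sigma y_gen T_unit T_sigma c_unit Tc).
rewrite -[M](mulmxK c_unit).
exact: (solution_locus iota_diff eta_sigma yy' y'y y_sigma T_unit T_sigma
  R_simple newC c_unit Tc Ms).
Qed.

Lemma locus_self : W T.
Proof. by move=> X _. Qed.

(** The morphism [h] extends to the base change by the identity of [U]; precomposing with [f] gives
    the translated point. *)
Lemma solution_translate (f : {rmorphism base_change eta j -> base_change eta j})
    (g : 'M[U]_n) M :
  diff_aut f -> map_mx f (map_mx (inl j) y) = map_mx (inl j) y *m map_mx (inr j) g ->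
  sol M -> sol (M *m g).
Proof.
move=> fa fy [h [heta hy]].
have [a|hU [hUl hUr]] := @tensor_rmorphism_pure _ _ _ i j U h idfun.
  by rewrite /= heta.
exists (hU \o f \o inl j); split=> [a|].
  by rewrite /= (diff_aut_inl fa) hUl heta.
have -> : map_mx (hU \o f \o inl j) y = map_mx hU (map_mx f (map_mx (inl j) y)).
  by apply/matrixP => a b; rewrite !mxE.
rewrite fy map_mxM; congr (_ *m _); apply/matrixP => a b; rewrite !mxE ?hUr //.
by rewrite hUl -hy mxE.
Qed.

Variable G : linAlgGroup k.
Variable theta : forall (B : comNzRingType) (j : {rmorphism k -> B}),
  'M[B]_(lag_dim G) -> {rmorphism base_change eta j -> base_change eta j}.
Hypothesis theta_aut : forall (B : comNzRingType) (j : {rmorphism k -> B}) g,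
  points G j g -> diff_aut (theta j g).
Hypothesis theta_onto : forall (B : comNzRingType) (j : {rmorphism k -> B}) f,
  diff_aut f -> exists2 g, points G j g & theta j g =1 f.
Hypothesis theta_inj : forall (B : comNzRingType) (j : {rmorphism k -> B}) g h,
  points G j g -> points G j h -> theta j g =1 theta j h -> g = h.
Hypothesis theta_mul : forall (B : comNzRingType) (j : {rmorphism k -> B}) g h,
  points G j g -> points G j h -> theta j (g *m h) =1 theta j g \o theta j h.
Hypothesis theta_natural : forall (B B' : comNzRingType) (j : {rmorphism k -> B})
    (j' : {rmorphism k -> B'}) (u : {rmorphism B -> B'}) g,
  (forall c, u (j c) = j' c) -> points G j g ->
  forall t, theta j' (map_mx u g) (tensor_map i j' idfun u t)
            = tensor_map i j' idfun u (theta j g t).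

(** The graph of rho: existence of [r] comes from [diff_aut_matrix], uniqueness from
    [matrix_inj]. *)
Definition cocycle (B : comNzRingType) (j : {rmorphism k -> B}) g (r : 'M[B]_n) : Prop :=
  map_mx (theta j g) (map_mx (inl j) y) = map_mx (inl j) y *m map_mx (inr j) r.

Lemma cocycle_mul g h r s : points G j g -> points G j h ->
  cocycle j g r -> cocycle j h s -> cocycle j (g *m h) (r *m s).
Proof.
move=> gG hG gr hs; rewrite /cocycle.
have -> : map_mx (theta j (g *m h)) (map_mx (inl j) y)
    = map_mx (theta j g) (map_mx (theta j h) (map_mx (inl j) y)).
  by apply/matrixP => a b; rewrite !mxE theta_mul.
rewrite hs map_mxM gr map_mxM mulmxA; congr (_ *m _).
by apply/matrixP => a b; rewrite !mxE (diff_aut_inr (theta_aut gG)).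
Qed.

(** The automorphism attached to 1 is idempotent and injective, hence the identity. *)
Lemma cocycle1 : cocycle j 1%:M 1%:M.
Proof.
have G1 : points G j 1%:M by apply: lag_one.
have [[f fK _] _ _] := theta_aut G1.
rewrite /cocycle map_mx1 mulmx1; apply/matrixP => a b; rewrite !mxE.
have := theta_mul G1 G1 (inl j (y a b)); rewrite mulmx1 /= => /(can_inj fK) <-.
by [].
Qed.

Lemma points_unit g : points G j g -> g \in unitmx.
Proof.
move=> [[d gd] _]; rewrite unitmxE unitfE.
by apply/eqP => g0; move/eqP: gd; rewrite g0 mul0r eq_sym oner_eq0.
Qed.

Lemma conj_unit (r r' : 'M[U]_n) : r *m r' = 1%:M ->
  c *m r *m c' \in unitmx /\ invmx (c *m r *m c') = c *m r' *m c'.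
Proof.
move=> rr'; have E : (c *m r *m c') *m (c *m r' *m c') = 1%:M.
  rewrite !mulmxA mulmxKV // -[c *m r *m r']mulmxA rr' mulmx1.
  exact: mulmxV.
have [u _] := mulmx1_unit E; split=> //.
by rewrite -[LHS]mulmx1 -E mulKmx.
Qed.

(** Translation by [r] preserves V = W c, which explains the conjugation. The matrix of the inverse
    of [g] inverts [r] and gives the opposite inclusion. *)
Lemma cocycle_stabilizer g r : points G j g -> cocycle j g r -> H (c *m r *m c').
Proof.
move=> gG gr; have gu := points_unit gG.
have g'G : points G j (invmx g) by apply: (lag_inv gG); exact: mulmxV.
have [s gs] : exists s, cocycle j (invmx g) s.
  exact: (diff_aut_matrix eta_sigma yy' y'y y_sigma newC (theta_aut g'G)).
have rs : r *m s = 1%:M.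
  apply: (@matrix_inj _ _ eta _ _ _ y'y _ j); rewrite -[RHS]cocycle1.
  by have := cocycle_mul gG g'G gr gs; rewrite mulmxV.
have stab h t : points G j h -> cocycle j h t -> forall M, W M -> W (M *m (c *m t *m c')).
  move=> hG ht M /locus_solution_iff Mc; apply/locus_solution_iff.
  rewrite !mulmxA mulmxKV //; exact: solution_translate (theta_aut hG) ht Mc.
have [u uE] := conj_unit rs; apply: right_stabilizerI => //.
  exact: stab gr.
by rewrite uE; apply: stab gs.
Qed.

(** * The automorphism attached to the universal point of H *)

Section UniversalPoint.
Variable X : gl_set U n.
Hypothesis XH : forall h, gl_carrier X h -> H h.
Local Notation B := (regular_fun X).
Local Notation jB := (regular_const X \o j).

(** Contracting the factor [R] first leaves an identity between regular functions, which is checked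
    at each point [h]; there [pairing_swap] turns it into [translate_descent]. *)
Lemma translates_locus (N N' : 'M[B]_n) : N *m N' = 1%:M ->
  (forall h : gl_sub X, exists2 M, W M & T *m c *m map_mx (regular_at h) N = M *m c) ->
  translates eta y y' jB N N'.
Proof.
move=> NN' NW e e0; have [l lE] := peval_mulmx e; rewrite lE.
pose l' := [seq (peval eta (mxval y y') p.1, peval (fun=> 1) (mxval N N') p.2) | p <- l].
have -> : \sum_(p <- l) peval (inl jB \o eta) (mxval (map_mx (inl jB) y) (map_mx (inl jB) y')) p.1
      * peval (fun=> 1) (mxval (map_mx (inr jB) N) (map_mx (inr jB) N')) p.2
    = \sum_(p <- l') inl jB p.1 * inr jB p.2.
  rewrite big_map; apply: eq_bigr => p _ /=; rewrite rmorph_peval_mx; congr (_ * _).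
  by rewrite rmorph_peval_mx; apply: eq_peval => // u; rewrite /= rmorph1.
apply: (@pairing_eval_left _ _ _ _ i jB) => [a|m ml]; first exact: tensor_in_scalar.
apply: regular_at_inj => h; rewrite rmorph0 rmorph_sum big_map.
pose lh := [seq (peval eta (mxval y y') p.1,
  peval (fun=> 1) (mxval (map_mx (regular_at h) N) (map_mx (regular_at h) N')) p.2) | p <- l].
have := @pairing_swap k R U i j lh _ m ml; rewrite big_map => E0; rewrite -[RHS]E0.
  apply: eq_bigr => p _; rewrite rmorphM /= regular_at_const; congr (_ * _).
  by rewrite rmorph_peval_mx; apply: eq_peval => // u; rewrite /= rmorph1.
move=> d dl; rewrite big_map.
have [M MW Mh] := NW h; have [h1 [h1eta h1y]] := Tc.
have [h2 [h2eta h2y]] := (locus_solution_iff M).1 MW.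
apply: (translate_descent iota_diff eta_sigma yy' y'y y_sigma T_unit T_sigma
  R_simple newC (h := h1) (h' := h2) (e := e)) => //.
- by rewrite -map_mxM NN' map_mx1.
- by rewrite h1y h2y Mh.
- by split; [exact: dl.1 | move=> a x; rewrite /= h1eta; exact: dl.2].
Qed.

(** The conjugate by [c] of the tautological matrix defines an automorphism over the ring of
    functions. Representability makes it a point of [G] over that ring, that is, a regular map to
    [G]. *)
Lemma universal_cocycle : exists gH : 'M[B]_(lag_dim G), points G jB gH /\
  forall h : gl_sub X, cocycle j (map_mx (regular_at h) gH) (c' *m sval h *m c).
Proof.
have [d gd] := generic_mx_det X; have [g' gg' g'g] := mx_inverse_from_det gd.
pose cst (M : 'M[U]_n) : 'M[B]_n := map_mx (regular_const X) M.
have at_cst (h : gl_sub X) (M : 'M[U]_n) : map_mx (regular_at h) (cst M) = M.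
  by apply/matrixP => a b; rewrite !mxE regular_at_const.
have cst_c : cst c *m cst c' = 1%:M by rewrite /cst -map_mxM mulmxV // map_mx1.
have cst_c' : cst c' *m cst c = 1%:M by rewrite /cst -map_mxM mulVmx // map_mx1.
have at_g' (h : gl_sub X) : map_mx (regular_at h) g' = invmx (sval h).
  have := congr1 (map_mx (regular_at h)) gg'; rewrite map_mxM generic_mxE map_mx1 => E.
  by rewrite -[RHS]mulmx1 -E mulKmx //; apply: (@gl_unit _ _ X); apply: svalP h.
have conjK (P Q : 'M[B]_n) : P *m Q = 1%:M ->
    (cst c' *m P *m cst c) *m (cst c' *m Q *m cst c) = 1%:M.
  move=> PQ; rewrite !mulmxA -[_ *m cst c *m cst c']mulmxA cst_c mulmx1.
  by rewrite -[_ *m P *m Q]mulmxA PQ mulmx1.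
pose N := cst c' *m generic_mx X *m cst c; pose N' := cst c' *m g' *m cst c.
have NN' : N *m N' = 1%:M by apply: conjK.
have N'N : N' *m N = 1%:M by apply: conjK.
have atN (h : gl_sub X) : map_mx (regular_at h) N = c' *m sval h *m c.
  by rewrite !map_mxM generic_mxE !at_cst.
have atN' (h : gl_sub X) : map_mx (regular_at h) N' = c' *m invmx (sval h) *m c.
  by rewrite !map_mxM at_g' !at_cst.
have [||f fa fy] := translates_aut eta_sigma yy' y'y y_sigma y_gen NN' N'N (j := jB).
- apply: translates_locus => // h; exists (T *m sval h); last first.
    by rewrite atN !mulmxA mulmxK.
  by apply: right_stabilizer_mul locus_self; apply/XH/(svalP h).
- apply: translates_locus => // h; exists (T *m invmx (sval h)); last first.
    by rewrite atN' !mulmxA mulmxK.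
  by apply: right_stabilizer_mul locus_self; apply/right_stabilizer_inv/XH/(svalP h).
have [gH gG gf] := theta_onto fa; exists gH; split=> // h; rewrite -atN.
have jE a : regular_at h (jB a) = j a by apply: regular_at_const.
apply: (base_change_matrix (u := regular_at h) jE (theta_natural jE gG)).
by rewrite -fy; apply/matrixP => a b; rewrite !mxE gf.
Qed.

End UniversalPoint.

Theorem galois_group_isom : alg_group_isom (points G j) H.
Proof.
have G1 : points G j 1%:M by apply: lag_one.
pose X := GlSet G1 points_unit.
have H_unit h : H h -> h \in unitmx by case.
pose Y := GlSet (right_stabilizer1 W) H_unit.
pose jX : {rmorphism k -> regular_fun X} := regular_const X \o j.
(* The matrix [rX] is rho at the tautological point of [G]; its entries are regular functions that
   specialize to rho at each point. *)
have guG : points G jX (generic_mx X) by apply: generic_mx_points.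
have [rX rXE] := diff_aut_matrix eta_sigma yy' y'y y_sigma newC (theta_aut guG).
pose cst (M : 'M[U]_n) : 'M[regular_fun X]_n := map_mx (regular_const X) M.
have at_cst (g : gl_sub X) (M : 'M[U]_n) : map_mx (regular_at g) (cst M) = M.
  by apply/matrixP => a b; rewrite !mxE regular_at_const.
have rX_cocycle (g : gl_sub X) : cocycle j (sval g) (map_mx (regular_at g) rX).
  have jE a : regular_at g (jX a) = j a by apply: regular_at_const.
  have := base_change_matrix (u := regular_at g) jE (theta_natural jE guG) rXE.
  by rewrite generic_mxE.
have [gH [gHG gHE]] := @universal_cocycle Y (fun h => id).
pose f := regular_map (cst c *m rX *m cst c'); pose f' := regular_map gH.
have fE g (Xg : points G j g) :
    f g = c *m map_mx (regular_at (exist _ g Xg : gl_sub X)) rX *m c'.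
  by rewrite [LHS](regular_mapE _ (exist _ g Xg : gl_sub X)) !map_mxM !at_cst.
have f'E h (Yh : H h) : f' h = map_mx (regular_at (exist _ h Yh : gl_sub Y)) gH.
  exact: (regular_mapE _ (exist _ h Yh : gl_sub Y)).
have f_cocycle g : points G j g -> cocycle j g (c' *m f g *m c).
  move=> Xg; rewrite (fE _ Xg) !mulmxA mulVmx // mul1mx mulmxKV //.
  exact: rX_cocycle (exist _ g Xg).
have f'_cocycle h : H h -> points G j (f' h) /\ cocycle j (f' h) (c' *m h *m c).
  move=> Yh; rewrite (f'E _ Yh); split; last exact: (gHE (exist _ h Yh)).
  by apply: gl_points_map gHG => a; apply: regular_at_const.
have fH g : points G j g -> H (f g).
  move=> Xg; have := cocycle_stabilizer Xg (f_cocycle _ Xg).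
  by rewrite !mulmxA mulmxV // mul1mx mulmxK.
(* An automorphism is determined by its effect on [y], so rho is injective. This settles one
   composite of [f] and [f']; uniqueness of the matrix settles the other. *)
have cocycle_inj g h r : points G j g -> points G j h ->
    cocycle j g r -> cocycle j h r -> g = h.
  move=> gG hG gr hr; apply: (theta_inj gG hG).
  apply: (diff_aut_ext yy' y'y y_gen (theta_aut gG) (theta_aut hG)).
  by rewrite [LHS]gr [RHS]hr.
have cocycle_uniq g r s : cocycle j g r -> cocycle j g s -> r = s.
  move=> gr gs; apply: (@matrix_inj _ _ eta _ _ _ y'y _ j).
  by rewrite -[LHS]gr -[RHS]gs.
have conj_inj (r s : 'M[U]_n) : c' *m r *m c = c' *m s *m c -> r = s.
  move=> /(congr1 (fun M => c *m M *m c')).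
  by rewrite !mulmxA mulmxV // !mul1mx !mulmxK.
exists f, f'; split.
- exact: (@regular_map_on _ _ X).
- exact: (@regular_map_on _ _ Y _ gH).
- move=> g Xg; split; first exact: fH.
  have [f'G f'r] := f'_cocycle _ (fH _ Xg).
  exact: cocycle_inj f'r (f_cocycle _ Xg).
- move=> h Yh; have [f'G f'r] := f'_cocycle _ Yh; split=> //.
  by apply: conj_inj; apply: cocycle_uniq (f_cocycle _ f'G) f'r.
- move=> g h Xg Xh; apply: conj_inj.
  apply: cocycle_uniq (f_cocycle _ (lag_mul Xg Xh)) _.
  have := cocycle_mul Xg Xh (f_cocycle _ Xg) (f_cocycle _ Xh).
  by rewrite !mulmxA mulmxK.
Qed.

End Isomorphism.

(** Since [idealr_closed] describes proper ideals, the definition yields this form by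
    contraposition: an ideal missing 1 is zero. *)
Lemma picard_vessiot_simple (K : diffField) n (A : 'M[K]_n) (R : diffRing)
    (eta : {rmorphism K -> R}) : picard_vessiot A eta -> sigma_simple (@rsigma R).
Proof.
move=> pv I ID IM Is x Ix x0; apply: contrapT => I1; apply: x0.
have I0 : I 0 by rewrite -(mul0r x); apply: IM.
apply: (pv_simple pv (I := fun z => `[< I z >])) => [|z /asboolP/Is Iz|]; last exact/asboolP.
  split=> [|| a u v /asboolP Iu /asboolP Iv]; first exact/asboolP.
    by apply/asboolP.
  by apply/asboolP/ID => //; apply: IM.
exact/asboolP.
Qed.

Lemma picard_vessiot_pexp (K : diffField) n (R : diffRing)
    (eta : {rmorphism K -> R}) (y : 'M[R]_n) :
  (forall S : {pred R}, subring_closed S -> (forall a, eta a \in S) ->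
    (forall a b, y a b \in S) -> (\det y)^-1 \in S -> forall x, x \in S) ->
  forall r, exists e, r = peval eta (mxval y (invmx y)) e.
Proof.
move=> gen r; pose S : {pred R} := fun r => `[< exists e, r = peval eta (mxval y (invmx y)) e >].
have Sc : subring_closed S.
  split; first by apply/asboolP; exists (PConst _ 1); rewrite /= rmorph1.
    move=> _ _ /asboolP[e ->] /asboolP[e' ->]; apply/asboolP.
    by exists (PAdd e (PMul (PConst _ (-1)) e')); rewrite /= rmorphN rmorph1 mulN1r.
  move=> _ _ /asboolP[e ->] /asboolP[e' ->]; apply/asboolP.
  by exists (PMul e e').
have Sy' a b : invmx y a b \in S by apply/asboolP; exists (PVar _ (true, a, b)).
pose Sm := GRing.isSubringClosed.Build R S Sc; pose S' : subringClosed R := HB.pack S Sm.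
apply/(@asboolP (exists e, r = peval eta (mxval y (invmx y)) e))/(gen S) => //.
- by move=> a; apply/asboolP; exists (PConst _ a).
- by move=> a b; apply/asboolP; exists (PVar _ (false, a, b)).
- by rewrite -det_inv; apply: (@det_rpred _ S').
Qed.

(** The determinant polynomial is nonzero because its value at the identity matrix is 1. *)
Lemma genY_unit (K : diffField) n : genY K n \in unitmx.
Proof.
have -> : genY K n = map_mx (@tofrac {mpoly K[n * n]}) (\matrix_(a, b) 'X_(mxvec_index a b)).
  by apply/matrixP => a b; rewrite !mxE.
rewrite unitmxE unitfE det_map_mx tofrac_eq0; apply/eqP => D0.
have := det_mpolyE (1%:M : 'M[K]_n); rewrite /det_mpoly D0 det1 [mx_eval _ _ _]rmorph0.
by move/eqP; rewrite eq_sym oner_eq0.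
Qed.

Lemma diffField_infinite (K : diffField) : ([set: nat]%classic #<= [set: K]%classic)%card.
Proof.
have K0 := (pcharf0P K).1 (@dfield_char0 K).
have le_inj m m' : (m <= m')%N -> m%:R = m'%:R :> K -> m = m'.
  move=> mm' /esym/eqP; rewrite -subr_eq0 -natrB // K0 subn_eq0 => m'm.
  by apply/eqP; rewrite eqn_leq mm'.
have inj : {in [set: nat]%classic &, injective (fun m => m%:R : K)}.
  move=> m m' _ _ mm'; case: (leqP m m') => [/le_inj|/ltnW/le_inj]; first exact.
  by move=> H; apply/esym/H/esym.
apply: card_le_trans (subset_card_le (@subsetT _ ((fun m => m%:R : K) @` setT)%classic)).
by have := inj_card_eq inj; rewrite card_eq_sym card_eq_le => /andP[].
Qed.

Theorem proposition4p15
  (kappa : Type) (U : diffField)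
  (U_generic : generic U) (U_sat : sufficiently_saturated kappa U)
  (K : diffField) (iota : {rmorphism K -> U}) (iota_diff : diff_morph iota)
  (K_small : smaller K kappa)
  (n : nat) (A : 'M[K]_n) (A_unit : A \in unitmx)
  (R' : diffRing) (eta : {rmorphism K -> R'})
  (R'_small : smaller R' kappa)
  (R'_PV : picard_vessiot A eta)
  (CR'_CK : no_new_constants eta) (CK_DK : periodic_are_constant K)
  (G : linAlgGroup (constField K)) (G_represents : represents_diff_aut eta G)
  (sigmaL : {rmorphism genField K n -> genField K n})
  (sigmaL_K : forall a, sigmaL (genConst n a) = genConst n (dsigma a))
  (sigmaL_Y : map_mx sigmaL (genY K n)
              = map_mx (@genConst K n) A *m genY K n)
  (phi : {rmorphism genField K n -> U})
  (phi_diff : forall x, phi (sigmaL x) = dsigma (phi x))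
  (phi_K : forall a, phi (genConst n a) = iota a) :
  alg_group_isom (points G (const_incl iota)) (groupH iota phi).
Proof.
have [y [y_unit y_sigma y_span]] := pv_generated R'_PV.
have eta_sigma := pv_extension R'_PV.
have yy' := mulmxV y_unit; have y'y := mulVmx y_unit.
have y_gen := picard_vessiot_pexp y_span.
have R_simple := picard_vessiot_simple R'_PV.
pose T := map_mx phi (genY K n).
have T_unit : T \in unitmx by rewrite map_unitmx genY_unit.
have T_sigma : map_mx dsigma T = map_mx iota A *m T.
  have -> : map_mx dsigma T = map_mx phi (map_mx sigmaL (genY K n)).
    by apply/matrixP => a b; rewrite !mxE phi_diff.
  rewrite sigmaL_Y map_mxM; congr (_ *m _).
  by apply/matrixP => a b; rewrite !mxE phi_K.
(* In characteristic 0 the field [K] is infinite, and [kappa] is strictly larger than [K]. *)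
have kappa_uncountable : infinite_set [set: kappa] /\ ~ countable [set: kappa].
  split; first exact: sat_infinite U_sat.
  by move=> kN; apply: K_small.2; apply: card_le_trans kN (diffField_infinite K).
have C_uncountable := constants_uncountable (sat_systems U_sat) kappa_uncountable.
have [c c_unit Tc] := solution_point_exists iota_diff eta_sigma yy' y'y y_sigma y_gen
  T_unit T_sigma U_generic C_uncountable.
have [theta [th_aut th_onto th_inj th_mul th_nat]] := G_represents.
exact: (galois_group_isom iota_diff eta_sigma yy' y'y y_sigma y_gen R_simple CR'_CK
  T_unit T_sigma c_unit Tc th_aut th_onto th_inj th_mul th_nat).
Qed.
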